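(* Let $\lambda\vdash n$ be a partition with $\ell(\lambda)\ge 3$, and let $J$ be a (finite) multiset of partitions of $n$, all of length three or more, such that $$\overline{F([M_\lambda])}=\sum_{\mu\in J}\overline{F([M_\mu])}\quad\text{in } \mathrm{QSym}/\mathfrak{m}^2,$$ where $[M_\tau]$ denotes the isomorphism class of loopless rank two matroids on $n$ elements indexed by the partition $\tau$. Then, taking the set of standard basis vectors of $\mathbb{R}^n$ as the common ground set, there exists a collection of representative matroids on this ground set, $M_\lambda\in[M_\lambda]$ and $M_\mu\in[M_\mu]$ for all $\mu\in J$ (one for each member of $J$, counted with multiplicity), which form a decomposition of matroid base polytopes $$Q(M_\lambda)=\bigcup_{\mu\in J}Q(M_\mu).$$
   Context: A composition is a finite sequence $\alpha=(\alpha_1,\dots,\alpha_m)$ of positive integers, with weight $|\alpha|=\sum\alpha_i$. For compositions of the same weight $n$, $\beta\preccurlyeq\alpha$ ($\beta$ refines $\alpha$) if the set of proper partial sums of $\alpha$ is contained in that of $\beta$. $\mathrm{QSym}$ is the ring of quasisymmetric functions with rational coefficients in ordered variables $x_1,x_2,\dots$, with monomial basis $\mathbf{x}^\alpha=\sum_{i_1<\cdots<i_m}x_{i_1}^{\alpha_1}\cdots x_{i_m}^{\alpha_m}$ and fundamental basis $L_\alpha=\sum_{\beta\preccurlyeq\alpha}\mathbf{x}^\beta$. $\mathrm{QSym}_d$ is its homogeneous component of degree $d$, and $\mathfrak{m}=\bigoplus_{d\ge1}\mathrm{QSym}_d$. For $f\in\mathrm{QSym}$, $\overline{f}$ is its image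 in $\mathrm{QSym}/\mathfrak{m}^2$. For a poset $P$ on a finite set of positive integers (a labeled poset), $F(P)=\sum_\pi L_{C(\pi)}$, summed over all linear extensions $\pi$ of $P$ (sequences listing each label once, with $x$ before $y$ whenever $x<_P y$), where $C(\pi)$ is the composition of lengths of successive maximal increasing runs of $\pi$. For a matroid $M$ with ground set $E(M)$ and bases $\mathcal{B}(M)$, and $B\in\mathcal{B}(M)$, let $P_B$ be the poset on $E(M)$ with $e<_{P_B}e'$ iff $e\in B$, $e'\notin B$ and $(B\setminus\{e\})\cup\{e'\}\in\mathcal{B}(M)$, given any strict labeling (i.e. one for which $x<_{P_B}y$ implies label of $x$ $>$ label of $y$; the choice does not affect $F(P_B)$). Then $F(M)=\sum_{B\in\mathcal{B}(M)}F(P_B)$; it depends only on the isomorphism class $[M]$. For a partition $\tau=(\tau_1,\dots,\tau_m)$ of $n$ with $m=\ell(\tau)\ge2$ parts, $M_\tau$ is the loopless rank two matroid on $n$ elements (unique up to isomorphism) having exactly $m$ parallelism classes, of cardinalities $\tau_1,\dots,\tau_m$. For a matroid $M$ on the ground set $\{e_1,\dots,e_n\}$ of standard basis vectors of $\mathbb{R}^n$, the matroid base polytope is $Q(M)=\mathrm{conv}\{\sum_{e_i\in B}e_i : B\in\mathcal{B}(M)\}$. A matroid base polytope decomposition of $Q(M)$ is an expression $Q(M)=\bigcup_{i=1}^tQ(M_i)$, where each $Q(M_i)$ is a matroid base polytope and for $i\ne j$ the intersection $Q(M_i)\cap Q(M_j)=Q(M_i\cap M_j)$ (with $M_i\cap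 M_j$ the matroid whose bases are the common bases) is a face of both $Q(M_i)$ and $Q(M_j)$. *)

(* Defs.v *)
From HB Require Import structures.
From mathcomp Require Import all_boot all_order all_algebra.
From mathcomp Require Import finmap multiset.
From mathcomp Require Import mathcomp_extra boolp classical_sets functions.
From mathcomp Require Import cardinality fsbigop reals.

Set Implicit Arguments.
Unset Strict Implicit.
Unset Printing Implicit Defensive.

Import Order.TTheory GRing.Theory Num.Theory.

Local Open Scope ring_scope.

(** * Quasisymmetric functions *)

(* A monomial in the ordered variables x_0, x_1, ... is the multiset of its
   variables: the exponent of x_i in [m] is [m i], and the product of two
   monomials is [(m1 `+` m2)%mset]. *)
Definition monomial : Type := {mset nat}%mset.
HB.instance Definition _ := Choice.on monomial.

(* Formal power series, as families of coefficients. The copied structure is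
   deliberately only additive: the pointwise product of coefficients is not the
   product of power series, which is [series_mul]. *)
Definition series : Type := monomial -> rat.
HB.instance Definition _ := GRing.Zmodule.copy series (monomial -> rat).

Definition series_mul (f g : series) : series := fun m =>
  \sum_(p \in [set p : monomial * monomial | (p.1 `+` p.2)%mset = m]%classic)
     f p.1 * g p.2.

Definition is_composition (a : seq nat) : bool := all (leq 1) a.

Definition proper_partial_sums (a : seq nat) : seq nat :=
  [seq sumn (take k a) | k <- iota 1 (size a).-1].

(* b refines a *)
Definition refines (b a : seq nat) : bool :=
  [&& is_composition b, is_composition a, sumn b == sumn a
    & all [in proper_partial_sums b] (proper_partial_sums a)].

(* If m = x_(i_1)^(a_1) ... x_(i_k)^(a_k) with i_1 < ... < i_k and all a_j > 0,
   then [exponents m] is the composition (a_1, ..., a_k). *)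
Definition exponents (m : monomial) : seq nat :=
  [seq (m : {mset nat}%mset) i | i <- sort leq (finsupp m)].

Definition mdegree (m : monomial) : nat := size (enum_mset m).

Definition monomial_qsym (a : seq nat) : series := fun m => (exponents m == a)%:R.

Definition fundamental_qsym (a : seq nat) : series :=
  \sum_(b \in [set b | refines b a]%classic) monomial_qsym b.

Definition quasisymmetric (f : series) : Prop :=
  forall m1 m2 : monomial, exponents m1 = exponents m2 -> f m1 = f m2.

Definition QSym_homog (d : nat) (f : series) : Prop :=
  quasisymmetric f /\ forall m : monomial, f m != 0 -> mdegree m = d.

(* The ideal m, direct sum of the components of degree 1, 2, ... *)
Definition QSym_ideal (f : series) : Prop :=
  exists (N : nat) (g : nat -> series),
    (forall d, QSym_homog d.+1 (g d)) /\ f = \sum_(d < N) g d.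

(* m^2, the additive span of the products of two elements of m *)
Definition QSym_ideal_sq (f : series) : Prop :=
  exists (N : nat) (g h : 'I_N -> series),
    (forall i, QSym_ideal (g i) /\ QSym_ideal (h i)) /\
    f = \sum_i series_mul (g i) (h i).

(* equality of the images in QSym / m^2 *)
Definition eq_mod_ideal_sq (f g : series) : Prop := QSym_ideal_sq (f - g).

(** * The generating function of a labeled poset *)

(* lengths of the maximal increasing runs of x :: s, where k - 1 earlier letters
   already belong to the run of x *)
Fixpoint run_lengths_from (k x : nat) (s : seq nat) : seq nat :=
  if s is y :: s' then
    if (x < y)%N then run_lengths_from k.+1 y s' else k :: run_lengths_from 1 y s'
  else [:: k].

Definition run_lengths (s : seq nat) : seq nat :=
  if s is x :: s' then run_lengths_from 1 x s' else [::].

Definition is_linear_extension (E : finType) (lt : rel E) (s : seq E) : bool :=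
  perm_eq s (enum E) &&
  [forall x, forall y, lt x y ==> (index x s < index y s)%N].

(* F(P) for the poset P whose elements are the labels [w x], ordered by [lt];
   the linear extensions are enumerated before applying the labels. *)
Definition F_poset (E : finType) (lt : rel E) (w : E -> nat) : series :=
  \sum_(s <- permutations (enum E) | is_linear_extension lt s)
     fundamental_qsym (run_lengths (map w s)).

Definition strict_labeling (E : finType) (lt : rel E) (w : E -> nat) : Prop :=
  [/\ injective w, forall x, (0 < w x)%N & forall x y, lt x y -> (w y < w x)%N].

(** * Matroids *)

Record matroid (E : finType) := Matroid {
  bases : {set {set E}};
  bases_neq0 : bases != finset.set0;
  bases_exchange : forall (A B : {set E}) (x : E),
    A \in bases -> B \in bases -> x \in A :\: B ->
    exists2 y, y \in B :\: A & y |: (A :\ x) \in bases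
}.

Section MatroidNotions.
Variables (E : finType) (M : matroid E).

Definition independent (A : {set E}) : bool := [exists B in bases M, A \subset B].

Definition rank : nat := (\max_(A : {set E} | independent A) #|A|)%N.

Definition is_loop (x : E) : bool := ~~ independent [set x].

Definition loopless : bool := [forall x, ~~ is_loop x].

Definition parallel : rel E := fun x y =>
  [&& ~~ is_loop x, ~~ is_loop y & (x == y) || ~~ independent [set x; y]].

Definition parallelism_classes : {set {set E}} :=
  equivalence_partition parallel [set x | ~~ is_loop x].

Definition basis_poset (B : {set E}) : rel E := fun e e' =>
  [&& e \in B, e' \notin B & e' |: (B :\ e) \in bases M].

(* One strict labeling of P_B: elements of B receive larger labels than the
   others. F(P_B) does not depend on the strict labeling. *)
Definition basis_label (B : {set E}) (e : E) : nat :=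
  ((e \in B) * #|E| + enum_rank e).+1%N.

Lemma basis_label_strict (B : {set E}) :
  strict_labeling (basis_poset B) (basis_label B).
Proof.
split=> [x y|//|x y /and3P[xB /negPf yB _]]; last first.
  rewrite /basis_label xB yB mul0n mul1n add0n ltnS.
  by rewrite (leq_trans (ltn_ord _)) ?leq_addr.
rewrite /basis_label => -[]; have := ltn_ord (enum_rank x).
have := ltn_ord (enum_rank y).
case: (x \in B); case: (y \in B); rewrite ?mul1n ?mul0n ?add0n.
- by move=> _ _ /addnI/val_inj/enum_rank_inj.
- by move=> ltyE _ yE; move: ltyE; rewrite -yE ltnNge leq_addr.
- by move=> _ ltxE xE; move: ltxE; rewrite xE ltnNge leq_addr.
- by move=> _ _ /val_inj/enum_rank_inj.
Qed.

Definition F_matroid : series :=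
  \sum_(B in bases M) F_poset (basis_poset B) (basis_label B).

End MatroidNotions.

Definition is_partition (n : nat) (t : seq nat) : bool :=
  [&& sorted geq t, all (leq 1) t & sumn t == n].

(* M belongs to the isomorphism class [M_t], for t a partition of n *)
Definition in_rank2_class (n : nat) (t : seq nat) (M : matroid 'I_n) : Prop :=
  [/\ loopless M, rank M = 2
    & perm_eq [seq #|C| | C : {set 'I_n} <- enum (parallelism_classes M)] t].

(** * Matroid base polytopes *)

(* The ground set of standard basis vectors e_1, ..., e_n of R^n is encoded by
   their indices. *)
Section Polytopes.
Variables (R : realType) (n : nat).

Definition basis_vertex (B : {set 'I_n}) : 'rV[R]_n :=
  \sum_(i in B) delta_mx 0 i.

Definition base_polytope (M : matroid 'I_n) : set 'rV[R]_n :=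
  [set x | exists c : {set 'I_n} -> R,
     [/\ forall B, 0 <= c B, \sum_(B in bases M) c B = 1
       & x = \sum_(B in bases M) c B *: basis_vertex B]]%classic.

(* Faces are cut out by valid linear inequalities; the whole polytope and the
   empty set are faces. *)
Definition is_face (G Q : set 'rV[R]_n) : Prop :=
  exists (u : 'rV[R]_n) (b : R),
    (forall x, Q x -> \sum_i u 0 i * x 0 i <= b) /\
    G = [set x | Q x /\ \sum_i u 0 i * x 0 i = b]%classic.

Definition base_polytope_decomposition (M : matroid 'I_n) (I : finType)
    (N : I -> matroid 'I_n) : Prop :=
  base_polytope M = (\bigcup_(i in [set: I]) base_polytope (N i))%classic /\
  forall i j : I, i != j -> exists K : matroid 'I_n,
    [/\ bases K = bases (N i) :&: bases (N j),
        (base_polytope (N i) `&` base_polytope (N j))%classic = base_polytope K,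
        is_face (base_polytope K) (base_polytope (N i))
      & is_face (base_polytope K) (base_polytope (N j))].

End Polytopes.

(* Main.v *)
Require Import Defs.
From mathcomp Require Import all_boot all_order all_algebra.
From mathcomp Require Import finmap multiset.
From mathcomp Require Import boolp classical_sets functions.
From mathcomp Require Import cardinality fsbigop reals.
From mathcomp Require Import zify ring lra.

(* Left multiplication by a primitive element of the dual algebra NSym is dual
   to a derivation of QSym, and evaluating the constant term after a derivation
   gives a functional that vanishes on m^2. Starting from H_2 - H_1^2 / 2 and
   taking repeated commutators with H_1 one gets derivations beta_k; on
   matroids with k elements the constant term of beta_k is Crapo's beta
   invariant up to a factor. Hence it vanishes on disconnected matroids, and for
   M_t, t a partition of n with m >= 2 parts, it gives a multiple of m - 2, while
   the commutator of beta_d and beta_(n-d) gives a multiple of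
   #{parts d} - #{parts n - d}: the only minors that contribute are the
   restriction to a parallelism class of size d and the contraction of a class
   of size n - d. So m - 2 and the differences #{parts d} - #{parts n - d} are
   additive along the relation in QSym / m^2; the case d = 1 follows from the
   others because the sum of n - 2 p over the parts p of t is n (m - 2).

   Take j whose partition mu_j has the largest part p among all mu_j. No mu_i
   has a part exceeding p, so by additivity all the other parts of mu_j occur in
   lambda. Replacing them in lambda by their sum n - p gives a partition with the
   additivity property for the remaining mu_i, hence by induction a decomposition
   of its polytope. Splitting the corresponding class A of size n - p again cuts
   off the polytope of mu_j: M_lambda is the union of the matroid where A is
   merged into one class and the one where the complement of A is. Two pieces
   meet in a common face because some class of one and some class of the other
   cover the ground set. *)

Set Implicit Arguments.
Unset Strict Implicit.
Unset Printing Implicit Defensive.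

Import Order.TTheory GRing.Theory Num.Theory.

Local Open Scope ring_scope.

(** * Derivations of QSym *)

Local Notation wfun := (seq nat -> rat^o).

(* A series is encoded by its coefficients at x_0^(e_0) x_1^(e_1) ..., zero
   exponents being allowed; in this encoding [quasi_shuffle] is the product of
   power series, and quasisymmetric series are [zero_insensitive]. *)
Fixpoint quasi_shuffle (f g : wfun) (e : seq nat) : rat :=
  if e is k :: e' then
    \sum_(i < k.+1) quasi_shuffle (f \o cons (i : nat)) (g \o cons (k - i)%N) e'
  else f [::] * g [::].

Definition zero_insensitive (f : wfun) : Prop :=
  forall e, f e = f [seq k <- e | (0 < k)%N].

Lemma quasi_shuffleDl (f1 f2 g : wfun) e :
  quasi_shuffle (f1 + f2) g e = quasi_shuffle f1 g e + quasi_shuffle f2 g e.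
Proof.
elim: e f1 f2 g => [|k e IH] f1 f2 g /=; first by rewrite mulrDl.
by rewrite -big_split; apply: eq_bigr => i _; exact: IH.
Qed.

Lemma quasi_shuffleDr (f g1 g2 : wfun) e :
  quasi_shuffle f (g1 + g2) e = quasi_shuffle f g1 e + quasi_shuffle f g2 e.
Proof.
elim: e f g1 g2 => [|k e IH] f g1 g2 /=; first by rewrite mulrDr.
by rewrite -big_split; apply: eq_bigr => i _; exact: IH.
Qed.

Lemma quasi_shuffleZl a (f g : wfun) e :
  quasi_shuffle (a *: f) g e = a * quasi_shuffle f g e.
Proof.
elim: e f g => [|k e IH] f g /=; first by rewrite -mulrA.
by rewrite mulr_sumr; apply: eq_bigr => i _; exact: IH.
Qed.

Lemma quasi_shuffleZr a (f g : wfun) e :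
  quasi_shuffle f (a *: g) e = a * quasi_shuffle f g e.
Proof.
elim: e f g => [|k e IH] f g /=; first by rewrite mulrCA.
by rewrite mulr_sumr; apply: eq_bigr => i _; exact: IH.
Qed.

Lemma quasi_shuffleBl (f1 f2 g : wfun) e :
  quasi_shuffle (f1 - f2) g e = quasi_shuffle f1 g e - quasi_shuffle f2 g e.
Proof.
by rewrite -scaleN1r quasi_shuffleDl quasi_shuffleZl mulN1r.
Qed.

Lemma quasi_shuffleBr (f g1 g2 : wfun) e :
  quasi_shuffle f (g1 - g2) e = quasi_shuffle f g1 e - quasi_shuffle f g2 e.
Proof.
by rewrite -scaleN1r quasi_shuffleDr quasi_shuffleZr mulN1r.
Qed.

(** The Leibniz rule is asked of [zero_insensitive] functions: splitting the first exponent produces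
    terms [f \o cons 0], which reduce to [f] for those. *)
Record qsym_derivation (D : wfun -> wfun) : Prop := QSymDerivation {
  derivation_linear : forall a f g, D (a *: f + g) = a *: D f + D g;
  derivation_closed : forall f, zero_insensitive f -> zero_insensitive (D f);
  derivation_leibniz : forall f g, zero_insensitive f -> zero_insensitive g ->
    D (quasi_shuffle f g) = quasi_shuffle (D f) g + quasi_shuffle f (D g) :> wfun
}.

Lemma zero_insensitive_cons k f :
  zero_insensitive f -> zero_insensitive (f \o cons k).
Proof.
move=> Qf e /=; rewrite Qf [RHS]Qf /=.
by case: (0 < k)%N; rewrite filter_id.
Qed.

Lemma zero_insensitive_cons0 (f : wfun) : zero_insensitive f -> f \o cons 0%N = f.
Proof. by move=> Qf; apply: funext => e /=; rewrite Qf [RHS]Qf. Qed.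

Lemma zero_insensitive_linear a f g :
  zero_insensitive f -> zero_insensitive g -> zero_insensitive (a *: f + g).
Proof. by move=> Qf Qg e; congr (a * _ + _); [exact: Qf | exact: Qg]. Qed.

Definition commutator (D1 D2 : wfun -> wfun) (f : wfun) : wfun :=
  D1 (D2 f) - D2 (D1 f).

Lemma qsym_derivation_commutator D1 D2 :
  qsym_derivation D1 -> qsym_derivation D2 -> qsym_derivation (commutator D1 D2).
Proof.
move=> [L1 Q1 M1] [L2 Q2 M2].
have addD D : (forall a f g, D (a *: f + g) = a *: D f + D g) ->
    forall f g : wfun, D (f + g) = D f + D g :> wfun.
  by move=> L f g; have := L 1 f g; rewrite !scale1r.
split.
- move=> a f g; rewrite /commutator !(L1, L2) scalerBr opprD.
  by rewrite addrACA.
- move=> f Qf; rewrite /commutator addrC -scaleN1r.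
  by apply: zero_insensitive_linear; auto.
move=> f g Qf Qg; rewrite /commutator M1 ?M2 ?(addD D1) ?(addD D2) // !(M1, M2); auto.
apply: funext => e.
have addE (u v : wfun) : (u + v) e = u e + v e by [].
have subE (u v : wfun) : (u - v) e = u e - v e by [].
rewrite subE !addE quasi_shuffleBl quasi_shuffleBr; ring.
Qed.

(** Dual to left multiplication by [H_1] in NSym. *)
Definition peel1 (f : wfun) : wfun := fun e => f (1%N :: e).

(* Twice the derivation dual to left multiplication by the power sum
   [H_2 - H_1 ^+ 2 / 2] of NSym. *)
Definition peel2 (f : wfun) : wfun :=
  fun e => (2 * (f (2%N :: e) : rat) - (f [:: 1%N, 1%N & e] : rat) : rat).

Lemma peel1_derivation : qsym_derivation peel1.
Proof.
split => // [f /zero_insensitive_cons|f g Qf Qg]; first exact.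
apply: funext => e; rewrite /peel1 /= 2!big_ord_recl big_ord0 /=.
by rewrite !zero_insensitive_cons0 // addr0 addrC.
Qed.

(** Twice the coefficient at exponent two contains the mixed product of [f \o cons 1] and
    [g \o cons 1] two times, exactly what the coefficient at two ones subtracts. *)
Lemma peel2_derivation : qsym_derivation peel2.
Proof.
split.
- move=> a f g; apply: funext => e; rewrite /peel2 !fctE /GRing.scale /=; ring.
- move=> f Qf e; have Q1 := zero_insensitive_cons 1%N Qf.
  have E2 := zero_insensitive_cons 2%N Qf e.
  have E11 := zero_insensitive_cons 1%N Q1 e.
  by rewrite /comp in E2 E11; rewrite /peel2 E2 E11.
move=> f g Qf Qg; apply: funext => e.
have peel2E h : peel2 h = 2 *: (h \o cons 2%N) - ((h \o cons 1%N) \o cons 1%N)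
  by [].
have Qf1 := zero_insensitive_cons 1%N Qf.
have Qg1 := zero_insensitive_cons 1%N Qg.
rewrite {1}/peel2 /= !big_ord_recl !big_ord0 /= !zero_insensitive_cons0 //.
rewrite /bump /= !subn0 !addr0 !addn0 subn1 addn1 /=.
rewrite [RHS](_ : _ = quasi_shuffle (peel2 f) g e + quasi_shuffle f (peel2 g) e) //.
rewrite !peel2E quasi_shuffleBl quasi_shuffleBr.
rewrite !quasi_shuffleZl !quasi_shuffleZr; ring.
Qed.

(* [beta k] lowers degrees by [k.+2], so that [beta 0] is [peel2]. *)
Fixpoint beta (k : nat) : wfun -> wfun :=
  if k is k'.+1 then commutator peel1 (beta k') else peel2.

Lemma beta_derivation k : qsym_derivation (beta k).
Proof.
elim: k => [|k IH]; first exact: peel2_derivation.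
exact: qsym_derivation_commutator peel1_derivation IH.
Qed.

(** * Power series as functions on exponent words *)

Definition monom (e : seq nat) : monomial :=
  [fsfun i in seq_fset tt (iota 0 (size e)) => nth 0%N e i | 0%N].

Lemma monomE e i : (monom e : {mset nat}%mset) i = nth 0%N e i.
Proof.
rewrite /monom fsfunE seq_fsetE mem_iota leq0n add0n /=.
by case: ltnP => // le_e_i; rewrite nth_default.
Qed.

Lemma exponents_monom e : exponents (monom e) = [seq k <- e | (0 < k)%N].
Proof.
rewrite /exponents.
have -> : sort leq (finsupp (monom e)) =
    [seq i <- iota 0 (size e) | (0 < nth 0 e i)%N].
  apply: (sorted_eq leq_trans anti_leq).
  - exact: sort_sorted leq_total _.
  - exact/(sorted_filter leq_trans)/iota_sorted.
  rewrite perm_sort; apply: uniq_perm; rewrite ?fset_uniq ?filter_uniq ?iota_uniq //.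
  move=> i; rewrite mem_finsupp monomE mem_filter mem_iota /= add0n lt0n.
  by case: ltnP; rewrite (andbT, andbF) // => /(nth_default 0%N) ->.
rewrite (eq_map (monomE e)) -[in RHS](mkseq_nth 0%N e) /mkseq filter_map.
by rewrite -filter_map.
Qed.

Fixpoint box (e : seq nat) : seq (seq nat) :=
  if e is k :: e' then [seq i :: a | i <- iota 0 k.+1, a <- box e'] else [:: [::]].

Definition vsub (e a : seq nat) : seq nat := [seq (p.1 - p.2)%N | p <- zip e a].

Lemma mem_box e a :
  (a \in box e) = (size a == size e) && all (fun p => (p.2 <= p.1)%N) (zip e a).
Proof.
elim: e a => [|k e IH] a; first by case: a.
apply/idP/idP => [/allpairsP[[j b] /= [jk bb ->]]|].
  have := mem_iota 0 k.+1 j; rewrite jk add0n ltnS => /esym /= jk'.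
  by rewrite /= eqSS jk' -IH.
case: a => // i a; rewrite [X in X -> _]/= eqSS andbCA -IH => /andP[ik aB].
apply: (allpairs_f (fun i a => i :: a)) => //.
by have := mem_iota 0 k.+1 i; rewrite add0n ltnS ik => ->.
Qed.

Lemma box_uniq e : uniq (box e).
Proof.
elim: e => // k e IH; apply: allpairs_uniq => //; first exact: iota_uniq.
by move=> [i a] [j b] _ _ /= [-> ->].
Qed.

Lemma quasi_shuffleE f g e :
  quasi_shuffle f g e = \sum_(a <- box e) f a * g (vsub e a).
Proof.
elim: e f g => [|k e IH] f g; first by rewrite big_seq1.
rewrite [LHS]/= big_allpairs_dep -/(index_iota 0 k.+1) big_mkord.
by apply: eq_bigr => i _; rewrite IH.
Qed.

Definition coef_word (f : series) : wfun := fun e => f (monom e).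

Lemma nth_vsub e a i : size a = size e ->
  nth 0%N (vsub e a) i = (nth 0 e i - nth 0 a i)%N.
Proof.
move=> se; have [lt_i|le_i] := ltnP i (size e).
  by rewrite (nth_map (0, 0)%N) ?size_zip ?se ?minnn // nth_zip.
by rewrite !nth_default ?se // size_map size_zip se minnn.
Qed.

Lemma all_zip_leq e a : size a = size e ->
  all (fun p => (p.2 <= p.1)%N) (zip e a) = [forall i : 'I_(size e), nth 0 a i <= nth 0 e i]%N.
Proof.
move=> se; apply/(all_nthP (0, 0)%N)/forallP => /=.
  by move=> le i; have := le i; rewrite size_zip se minnn nth_zip ?se //=; apply.
by move=> le i; rewrite size_zip se minnn nth_zip // => lt; exact: le (Ordinal lt).
Qed.

(** The factorisations of [monom e] correspond to the words [a] of [box e], with cofactor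
    [vsub e a]; neither factor can involve a variable beyond the length of [e]. *)
Lemma coef_word_mul f g :
  coef_word (series_mul f g) = quasi_shuffle (coef_word f) (coef_word g).
Proof.
apply: funext => e; rewrite quasi_shuffleE /coef_word /series_mul.
pose h a := (monom a, monom (vsub e a)).
have inj_h : {in box e &, injective h}.
  move=> a b; rewrite !mem_box => /andP[/eqP sa _] /andP[/eqP sb _] [/msetP mab _].
  apply: (@eq_from_nth _ 0%N) => [|i _]; first by rewrite sa.
  by have := mab i; rewrite !monomE.
transitivity (\sum_(p <- [seq h a | a <- box e]) f p.1 * g p.2); last by rewrite big_map.
rewrite [RHS]fsbig_seq ?map_inj_in_uniq ?box_uniq //.
apply: eq_fsbigl.
apply/seteqP; split => [[m1 m2] /= /msetP mE|p /= /mapP[a]].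
  have {}mE i : (m1 i + m2 i = nth 0 e i)%N by rewrite -monomE -mE msetE2.
  have sE : size (mkseq m1 (size e)) = size e by rewrite size_mkseq.
  apply/mapP; exists (mkseq m1 (size e)).
    rewrite mem_box sE eqxx all_zip_leq //; apply/forallP => i.
    by rewrite nth_mkseq // -mE leq_addr.
  have nE i : nth 0%N (mkseq m1 (size e)) i = m1 i.
    have [lt|le] := ltnP i (size e); first by rewrite nth_mkseq.
    rewrite nth_default ?size_mkseq //; have := mE i.
    by rewrite (nth_default 0%N le) => /eqP; rewrite addn_eq0 => /andP[/eqP].
  congr (_, _); apply/msetP => i; rewrite monomE ?nE // nth_vsub // nE -mE.
  by rewrite addKn.
rewrite mem_box => /andP[/eqP sa]; rewrite all_zip_leq // => /forallP le ->.
apply/msetP => i; rewrite msetE2 !monomE nth_vsub //.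
have [lt|ge] := ltnP i (size e); first by rewrite subnKC // (le (Ordinal lt)).
by rewrite !nth_default ?sa.
Qed.

Lemma coef_word_zero_insensitive f :
  quasisymmetric f -> zero_insensitive (coef_word f).
Proof. by move=> Qf e; apply: Qf; rewrite !exponents_monom filter_id. Qed.

Lemma QSym_ideal_coef f : QSym_ideal f ->
  zero_insensitive (coef_word f) /\ coef_word f [::] = 0.
Proof.
move=> [N [g [hom ->]]].
have sumE m : (\sum_(d < N) g d) m = \sum_(d < N) g d m by rewrite fct_sumE.
split=> [e|]; rewrite /coef_word !sumE.
  by apply: eq_bigr => d _; have [/coef_word_zero_insensitive/(_ e)] := hom d.
apply: big1 => d _; have [_ deg] := hom d; apply/eqP; apply: contraT => /deg.
suff -> : mdegree (monom [::]) = 0%N by [].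
rewrite /mdegree; have -> : monom [::] = mset0 :> {mset nat}%mset.
  by apply/msetP => i; rewrite monomE mset0E nth_nil.
by rewrite enum_mset0.
Qed.

(** At the empty word each Leibniz term of a product keeps the constant term of one of the factors,
    which is zero in the ideal. *)
Lemma derivation_ideal_sq D f : qsym_derivation D -> QSym_ideal_sq f ->
  D (coef_word f) [::] = 0.
Proof.
move=> [lin _ leib] [N [g [h [id ->]]]].
have lin0 : D 0 = 0 :> wfun.
  by have := lin 1 0 0; rewrite !scale1r addr0 => /eqP; rewrite eq_sym -subr_eq0 addrK => /eqP.
elim: N g h id => [|N IH] g h id.
  rewrite big_ord0; have -> : coef_word 0 = 0 by [].
  by rewrite lin0.
rewrite big_ord_recl; set G := \sum_(i < N) _.
have -> : coef_word (series_mul (g ord0) (h ord0) + G) =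
  1 *: coef_word (series_mul (g ord0) (h ord0)) + coef_word G by rewrite scale1r.
have [/QSym_ideal_coef[Qg g0] /QSym_ideal_coef[Qh h0]] := id ord0.
have GE : D (coef_word G) [::] = 0 by apply: IH => i; exact: id.
rewrite lin scale1r coef_word_mul leib //.
transitivity (quasi_shuffle (D (coef_word (g ord0))) (coef_word (h ord0)) [::]
   + quasi_shuffle (coef_word (g ord0)) (D (coef_word (h ord0))) [::]
   + D (coef_word G) [::]) => //.
by rewrite /= g0 h0 GE mul0r mulr0 !addr0.
Qed.

(** * Values on matroids of rank at most two *)

(* [rank0 l] and [rank1 l r] are the quasisymmetric functions of the matroid
   with [l] loops, and of the rank one matroid with [l] loops and [r] other
   elements; the recursions split off the block of lowest variables. *)
Fixpoint rank0_coef (e : seq nat) (l : nat) : rat :=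
  if e is k :: e' then 'C(l, k)%:R * rank0_coef e' (l - k) else (l == 0%N)%:R.

Definition rank0 (l : nat) : wfun := fun e => rank0_coef e l.

Fixpoint rank1_coef (e : seq nat) (l r : nat) : rat :=
  if e is k :: e' then
    'C(l, k)%:R * rank1_coef e' (l - k) r +
    'C(l, k.-1)%:R * r%:R * rank0_coef e' (l + r - k)
  else 0.

Definition rank1 (l r : nat) : wfun := fun e => rank1_coef e l r.

(* [F (M_t)] on words over 1 and 2, the only ones that [peel1] and [peel2] read. *)
Definition rank2 (n : nat) (t : seq nat) : wfun := fun e =>
  match e with
  | 1%N :: e' => \sum_(p <- t) p%:R * rank1 p.-1 (n - p) e'
  | 2%N :: e' => (\sum_(p <- t) p%:R * (n - p)%:R) / 2 * rank0 (n - 2) e'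
  | _ => 0
  end.

Lemma natr_ffactSr (n m : nat) :
  (n ^_ m.+1)%:R = (n ^_ m)%:R * (n%:R - m%:R) :> rat.
Proof.
rewrite ffactnSr natrM; have [le|lt] := leqP m n; first by rewrite natrB.
by rewrite ffact_small // !mul0r.
Qed.

Lemma natr_bin2 n : 2 * 'C(n, 2)%:R = n%:R * (n%:R - 1) :> rat.
Proof. by rewrite mulrC -natrM bin_ffact natr_ffactSr ffactn1. Qed.

Lemma peel1_rank0 l : peel1 (rank0 l) = l%:R *: rank0 l.-1.
Proof. by apply: funext => e; rewrite /peel1 /rank0 /= bin1 subn1. Qed.

(** [rank0 l] counts the distributions of the loops into blocks: twice the choices of a pair equal
    the choices of two loops in succession. *)
Lemma peel2_rank0 l : peel2 (rank0 l) = 0.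
Proof.
apply: funext => e; rewrite /peel2 /rank0 /= !bin1 -subnDA.
rewrite mulrA natr_bin2.
case: l => [|l]; first by rewrite !mul0r subr0.
by rewrite subn1 -natr1 addrK mulrA subrr.
Qed.

Lemma peel1_rank1 l r :
  peel1 (rank1 l r) = l%:R *: rank1 l.-1 r + r%:R *: rank0 (l + r).-1.
Proof.
by apply: funext => e; rewrite /peel1 /rank1 /= bin1 bin0 mul1r !subn1.
Qed.

Lemma peel2_rank1 l r :
  peel2 (rank1 l r) = - (r ^_ 2)%:R *: rank0 (l + r - 2).
Proof.
apply: funext => e; rewrite /peel2 /rank1 /= !bin1 !bin0.
rewrite [RHS](_ : _ = - (r ^_ 2)%:R * rank0_coef e (l + r - 2)) //.
rewrite -!subnDA !addn1 natr_ffactSr ffactn1 !mulrDr !mulrA natr_bin2 !mulr1 mul1r.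
have -> : l%:R * (l - 1)%:R = l%:R * (l%:R - 1) :> rat.
  by case: l => [|l]; rewrite ?mul0r // subn1 -natr1 addrK.
have -> : l%:R * r%:R * rank0_coef e (l - 1 + r - 1) =
          l%:R * r%:R * rank0_coef e (l + r - 2).
  case: l => [|l]; first by rewrite !mul0r.
  by congr (_ * rank0_coef _ _); lia.
have -> : r%:R * (l + r - 1)%:R = r%:R * (l%:R + r%:R - 1) :> rat.
  by case: r => [|r]; rewrite ?mul0r // addnS subn1 -natr1 natrD addrA addrK.
ring.
Qed.

Section LinearOperator.
Variable D : wfun -> wfun.
Hypothesis lin : forall a f g, D (a *: f + g) = a *: D f + D g.

Lemma linear_op0 : D 0 = 0.
Proof.
have := lin 1 0 0; rewrite !scale1r addr0 => /eqP.
by rewrite eq_sym -subr_eq0 addrK => /eqP.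
Qed.

Lemma linear_opZ a f : D (a *: f) = a *: D f.
Proof. by have := lin a f 0; rewrite linear_op0 !addr0. Qed.

Lemma linear_op_sum (I : Type) (s : seq I) (P : pred I) (a : I -> rat) (f : I -> wfun) :
  D (\sum_(i <- s | P i) a i *: f i) = \sum_(i <- s | P i) a i *: D (f i).
Proof.
elim: s => [|i s IH]; first by rewrite !big_nil linear_op0.
by rewrite !big_cons; case: (P i); rewrite ?lin IH.
Qed.
End LinearOperator.

Lemma beta_linear k a f g : beta k (a *: f + g) = a *: beta k f + beta k g.
Proof. exact: derivation_linear (beta_derivation k) a f g. Qed.

Lemma peel1_linear a f g : peel1 (a *: f + g) = a *: peel1 f + peel1 g.
Proof. by []. Qed.

Lemma beta_rank0 k l : beta k (rank0 l) = 0.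
Proof.
elim: k l => [|k IH] l; first exact: peel2_rank0.
rewrite /= /commutator IH peel1_rank0 (linear_opZ (@beta_linear k)) IH.
by rewrite (linear_op0 peel1_linear) scaler0 subr0.
Qed.

(** In the commutator the outer [peel1] brings the factor [l + r - (k + 2)] and the inner one the
    factor [l]; the difference [r - (k + 2)] extends the falling factorial. The [rank0] term of the
    inner one is killed by [beta k]. *)
Lemma beta_rank1 k l r :
  beta k (rank1 l r) = - (r ^_ k.+2)%:R *: rank0 (l + r - k.+2).
Proof.
elim: k l => [|k IH] l; first exact: peel2_rank1.
rewrite /= /commutator IH peel1_rank1 beta_linear (linear_opZ (@beta_linear k)).
rewrite beta_rank0 scaler0 addr0 IH (linear_opZ peel1_linear) peel1_rank0.
have [lt|le] := ltnP r k.+2.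
  by rewrite !ffact_small ?ltnS ?(ltnW lt) // mulr0n oppr0 !scale0r scaler0 subrr.
rewrite (natr_ffactSr r k.+2) natrB; last by lia.
case: l => [|l]; first by rewrite scale0r subr0 scalerA !add0n [in RHS]subnS mulNr.
rewrite (_ : l.+1.-1 + r - k.+2 = l.+1 + r - k.+3)%N; last by lia.
rewrite -subnS !scalerA -scalerBl natrD; congr (_ *: _); ring.
Qed.

Lemma rank2_peel1 n t :
  peel1 (rank2 n t) = \sum_(p <- t) p%:R *: rank1 p.-1 (n - p).
Proof. by apply: funext => e; rewrite fct_sumE. Qed.

(** For [m] at least two, the coefficient of [rank0 (n - m)] in [beta (m - 2) (rank2 n t)], solved
    in closed form from its recursion. *)
Definition rank2_beta (n : nat) (t : seq nat) (m : nat) : rat :=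
  \sum_(p <- t) ((p ^_ m)%:R - ((n - p) ^_ m)%:R) + ((size t)%:R - 2) * (n ^_ m)%:R.

Section Rank2.
Variables (n : nat) (t : seq nat).
Hypothesis sum_t : sumn t = n.

Let le_t p : p \in t -> (p <= n)%N.
Proof. by rewrite -sum_t => pt; rewrite (perm_sumn (perm_to_rem pt)) /= leq_addr. Qed.

Let sum_tR : \sum_(p <- t) p%:R = n%:R :> rat.
Proof. by rewrite -natr_sum -sumnE sum_t. Qed.

(** The summand is affine in [p], so only the number of parts and their sum enter. *)
Lemma rank2_beta2 : rank2_beta n t 2 = 0.
Proof.
rewrite /rank2_beta.
have -> : \sum_(p <- t) ((p ^_ 2)%:R - ((n - p) ^_ 2)%:R) =
   \sum_(p <- t) (2 * (n%:R - 1) * p%:R - (n%:R * (n%:R - 1)) * 1) :> rat.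
  rewrite big_seq [RHS]big_seq; apply: eq_bigr => p /le_t le.
  rewrite !natr_ffactSr !ffactn0 natrB //; ring.
rewrite big_split /= sumrN -!mulr_sumr sum_tR natr_ffactSr ffactn1.
rewrite big_const_seq count_predT iter_addr addr0; ring.
Qed.

Lemma rank2_betaS m : rank2_beta n t m.+1 =
  rank2_beta n t m * (n - m)%:R
  - \sum_(p <- t) ((p ^_ m)%:R * (n - p)%:R - p%:R * ((n - p) ^_ m)%:R).
Proof.
rewrite /rank2_beta; have [lt|le] := ltnP n m.
  have pm p : p \in t -> (p < m)%N by move/le_t => /leq_ltn_trans; exact.
  have npm p : (n - p < m)%N by rewrite (leq_ltn_trans (leq_subr _ _)).
  have npm' p : (n - p < m.+1)%N by rewrite ltnW ?ltnS // npm.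
  rewrite (eqP (ltnW lt)) !mulr0 ffact_small 1?ltnW // mulr0.
  rewrite big_seq [\sum_(p <- _) (_ * _ - _)]big_seq !big1 ?subr0 ?addr0 // => p /pm pt.
    by rewrite !ffact_small // mul0r mulr0 subr0.
  by rewrite !ffact_small ?subr0 // ltnW.
rewrite [in RHS]natrB // [RHS]addrC [in RHS]mulrDl addrA.
rewrite natr_ffactSr [in LHS]mulrA; congr (_ + _); rewrite addrC mulr_suml -sumrB.
rewrite big_seq [RHS]big_seq; apply: eq_bigr => p /le_t le_p.
rewrite !natr_ffactSr natrB //; ring.
Qed.

(** The [rank1] terms come from repeated peeling inside one class. Each commutator also turns
    [rank1] into [rank0] in two ways, by [peel1] on these terms and by [beta k] on the terms of
    [rank2_peel1]; [rank2_betaS] collects both. *)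
Lemma beta_rank2 k : beta k (rank2 n t) =
  - (\sum_(p <- t) (p ^_ k.+2)%:R *: rank1 (p - k.+2) (n - p))
  + rank2_beta n t k.+2 *: rank0 (n - k.+2).
Proof.
elim: k => [|k IH].
  rewrite rank2_beta2 scale0r addr0; apply: funext => e.
  rewrite /= /peel2 /rank2 mulrA mulrCA divff ?mulr1 // opprfctE fct_sumE.
  rewrite mulr_suml -sumrB -sumrN.
  rewrite big_seq [RHS]big_seq; apply: eq_bigr => p /le_t le_p.
  rewrite [rank1 _ _ _]/= bin1 bin0 [RHS](_ : _ = - ((p ^_ 2)%:R * rank1 (p - 2) (n - p) e)) //.
  rewrite natr_ffactSr ffactn1 mul1r; case: p le_p => [|p] le_p; first by rewrite !mul0r subrr oppr0.
  rewrite subn1 /= (_ : p + (n - p.+1) - 1 = n - 2)%N; last by lia.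
  rewrite -natr1 /rank1 /rank0 !subn2 /=; ring.
rewrite [LHS]/= /commutator IH rank2_peel1 (linear_op_sum (@beta_linear k)).
rewrite -scaleN1r peel1_linear (linear_op_sum peel1_linear) (linear_opZ peel1_linear).
rewrite peel1_rank0 -subnS (rank2_betaS k.+2) scalerA scalerBl.
rewrite scaleN1r addrAC [RHS]addrCA [RHS]addrC; congr (_ + _).
rewrite scaler_suml -!opprD; congr (- _).
rewrite -!big_split /= big_seq [RHS]big_seq; apply: eq_bigr => p /le_t le_p.
rewrite beta_rank1 peel1_rank1 !scalerDr !scalerA -subnS (ffactnSr p k.+2) natrM -addrA.
congr (_ + _).
(* For [p < k + 2] the falling factorial vanishes, so the truncated index does not matter; likewise
   below for [p = 0]. *)
have -> : ((p ^_ k.+2)%:R * (n - p)%:R) *: rank0 (p - k.+2 + (n - p)).-1 =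
          ((p ^_ k.+2)%:R * (n - p)%:R) *: rank0 (n - k.+3).
  have [lt|le] := ltnP p k.+2; first by rewrite ffact_small // mul0r !scale0r.
  by congr (_ *: rank0 _); lia.
have -> : (p%:R * - ((n - p) ^_ k.+2)%:R) *: rank0 (p.-1 + (n - p) - k.+2) =
          (p%:R * - ((n - p) ^_ k.+2)%:R) *: rank0 (n - k.+3).
  case: p le_p => [|p] le_p; first by rewrite !mul0r !scale0r.
  by congr (_ *: rank0 _); lia.
by rewrite -scalerDl mulrN.
Qed.

End Rank2.

(** [beta e] kills the [rank0] term, and the falling factorials of [p] and [n - p] are both nonzero
    only if [p >= d + 2] and [n - p >= e + 2], that is, [p = d + 2]. *)
Lemma beta_beta_rank2 n t d e : sumn t = n -> (d.+2 + e.+2 = n)%N ->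
  beta e (beta d (rank2 n t)) [::] =
  (d.+2`! * e.+2`!)%:R * (count_mem d.+2 t)%:R.
Proof.
move=> sum_t deE; rewrite beta_rank2 // addrC beta_linear beta_rank0 scaler0 add0r.
rewrite -scaleN1r (linear_opZ (@beta_linear e)) (linear_op_sum (@beta_linear e)).
rewrite scaleN1r opprfctE fct_sumE -sumrN.
rewrite -sum1_count natr_sum mulr_sumr [RHS]big_mkcond [LHS]big_seq [RHS]big_seq.
apply: eq_bigr => p pt.
have le_p : (p <= n)%N by rewrite -sum_t (perm_sumn (perm_to_rem pt)) leq_addr.
rewrite beta_rank1 [LHS](_ : _ = - ((p ^_ d.+2)%:R *
  (- ((n - p) ^_ e.+2)%:R * rank0 (p - d.+2 + (n - p) - e.+2) [::]))) //.
rewrite mulNr mulrN opprK /=.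
have [->|neq] := eqVneq p d.+2.
  rewrite (_ : n - d.+2 = e.+2)%N; last by lia.
  by rewrite !ffactnn subnn add0n subnn /rank0 /= !mulr1 natrM.
have [lt|le] := ltnP p d.+2; first by rewrite ffact_small // mul0r.
by rewrite (@ffact_small (n - p)) ?mul0r ?mulr0 //; lia.
Qed.

Lemma commutator_beta_rank2 n t d e : sumn t = n -> (d.+2 + e.+2 = n)%N ->
  commutator (beta e) (beta d) (rank2 n t) [::] =
  (d.+2`! * e.+2`!)%:R * ((count_mem d.+2 t)%:R - (count_mem e.+2 t)%:R).
Proof.
move=> sum_t deE; rewrite mulrBr -(beta_beta_rank2 sum_t deE).
by rewrite mulnC -(beta_beta_rank2 sum_t (etrans (addnC _ _) deE)).
Qed.

(** At the empty word [rank1] is zero, and every part lies strictly between [0] and [n], so of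
    [rank2_beta] only the term with the number of parts survives. *)
Lemma beta_rank2_top n t : (1 < n)%N -> sumn t = n -> all (fun p => (0 < p < n)%N) t ->
  beta (n - 2) (rank2 n t) [::] = ((size t)%:R - 2) * n`!%:R.
Proof.
move=> n1 sum_t /allP t_lt.
have nE : ((n - 2).+2 = n)%N by lia.
rewrite beta_rank2 // nE subnn.
rewrite [LHS](_ : _ = - (\sum_(p <- t) (p ^_ n)%:R *: rank1 (p - n) (n - p)) [::]
  + rank2_beta n t n * rank0 0 [::]) //.
rewrite fct_sumE big1 ?oppr0 ?add0r; last by move=> p _; rewrite /= [LHS]mulr0.
rewrite mulr1 /rank2_beta big_seq big1 ?add0r ?ffactnn // => p /t_lt /andP[p0 pn].
by rewrite !ffact_small ?subrr //; lia.
Qed.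

(** The values of every [beta k] at words over 1 and 2 depend only on values at such words, so
    [F_matroid] is computed just there. *)
Definition agree12 (f g : wfun) : Prop :=
  forall e, all [in [:: 1%N; 2%N]] e -> f e = g e.

Lemma agree12_beta k f g : agree12 f g -> agree12 (beta k f) (beta k g).
Proof.
elim: k f g => [|k IH] f g fg e /= e12.
  by rewrite /peel2 !fg //= !inE /=.
rewrite /commutator -[LHS]/(beta k f (1%N :: e) - _) -[RHS]/(beta k g (1%N :: e) - _).
congr (_ - _); apply: IH => // e' e'12; exact: fg.
Qed.

(** * Coefficients of F(M) *)

Lemma proper_partial_sums_cons k e : e != [::] ->
  proper_partial_sums (k :: e) = k :: [seq (k + i)%N | i <- proper_partial_sums e].
Proof.
case: e => // k' e _; rewrite /proper_partial_sums /= addn0; congr (_ :: _).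
by rewrite (iotaDl 1 1) -!map_comp; apply: eq_map.
Qed.

Fixpoint descents (j x : nat) (s : seq nat) : seq nat :=
  if s is y :: s' then
    if (x < y)%N then descents j.+1 y s' else j :: descents j.+1 y s'
  else [::].

Lemma descentsD i j x s : [seq (i + d)%N | d <- descents j x s] = descents (i + j) x s.
Proof. by elim: s j x => //= y s IH j x; case: ifP => _; rewrite /= IH addnS. Qed.

Lemma descents_geq j x s : all (leq j) (descents j x s).
Proof.
elim: s j x => //= y s IH j x.
have le : all (leq j) (descents j.+1 y s) by apply: sub_all (IH j.+1 y) => i /ltnW.
by case: ifP; rewrite //= leqnn.
Qed.

Lemma run_lengths_from_neq0 k x s : run_lengths_from k x s != [::].
Proof. by elim: s k x => //= y s IH k x; case: ifP. Qed.

Lemma proper_partial_sums_run k x s :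
  proper_partial_sums (run_lengths_from k x s) = descents k x s.
Proof.
elim: s k x => //= y s IH k x; case: ifP => _ //.
by rewrite proper_partial_sums_cons ?run_lengths_from_neq0 // IH descentsD addn1.
Qed.

Lemma run_lengths_composition s : is_composition (run_lengths s).
Proof.
case: s => // x s /=; rewrite /is_composition.
have : (0 < 1)%N by []; elim: s {2 4}1%N x => [|y s IH] k x k0 /=; first by rewrite k0.
by case: ifP => _; rewrite ?IH //= k0 IH.
Qed.

Lemma sumn_run_lengths s : sumn (run_lengths s) = size s.
Proof.
case: s => // x s /=; rewrite -[(size s).+1]add1n.
elim: s 1%N x => [|y s IH] k x /=; first by [].
by case: ifP => _ /=; rewrite IH ?addnS ?addSn ?add0n.
Qed.

Lemma refines_run_nil e : is_composition e ->
  refines e (run_lengths [::]) = (e == [::]).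
Proof. by case: e => [|[|k] e] //; rewrite /refines => ->. Qed.

Lemma refines_nil_run x s : refines [::] (run_lengths (x :: s)) = false.
Proof. by rewrite /refines sumn_run_lengths andbF. Qed.

Lemma all_mem_addn k (P Q : seq nat) : all (leq 1) Q ->
  all [in k :: [seq (k + i)%N | i <- P]] [seq (k + i)%N | i <- Q] = all [in P] Q.
Proof.
move=> /allP Q1; rewrite all_map; apply: eq_in_all => i /Q1 i1 /=.
by rewrite inE -{2}[k]addn0 eqn_add2l (gtn_eqF i1) mem_map //; apply: addnI.
Qed.

Lemma refines_run e x s : is_composition e ->
  refines e (run_lengths (x :: s)) =
  (sumn e == (size s).+1) && all [in proper_partial_sums e] (descents 1 x s).
Proof.
move=> ce; rewrite /refines ce run_lengths_composition sumn_run_lengths.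
by rewrite -(proper_partial_sums_run 1 x s).
Qed.

(** A first block of size one makes 1 a partial sum, so a descent after the first letter is always
    allowed. *)
Lemma refines_cons1 e x s : is_composition e ->
  refines (1%N :: e) (run_lengths (x :: s)) = refines e (run_lengths s).
Proof.
move=> ce; rewrite refines_run //; case: s => [|y s].
  rewrite refines_run_nil //; case: e ce => [|k e] // /andP[k0 _].
  by rewrite /= eqSS; case: k k0.
rewrite refines_run // eqSS; case: eqP => //= se.
rewrite proper_partial_sums_cons; last by case: e se {ce}.
rewrite -(all_mem_addn 1 _ (descents_geq _ _ _)) descentsD.
by case: ifP => _ //; rewrite [all _ (_ :: _)]/= inE eqxx.
Qed.

(** Inside a first block of size two no run may end, whereas a descent after it is allowed. *)
Lemma refines_cons2 e x y s : is_composition e ->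
  refines (2%N :: e) (run_lengths [:: x, y & s]) =
  (x < y)%N && refines e (run_lengths s).
Proof.
move=> ce; rewrite refines_run //; case: s => [|z s].
  rewrite refines_run_nil //; case: e ce => [|k e] /=; first by case: ifP.
  by case: k => // k _; rewrite andbF.
rewrite refines_run // !eqSS; case: eqP => //= se; last by rewrite andbF.
rewrite proper_partial_sums_cons; last by case: e se {ce}.
rewrite -(all_mem_addn 2 _ (descents_geq _ _ _)) descentsD.
have n1 : (1%N \in 2%N :: [seq (2 + i)%N | i <- proper_partial_sums e]) = false.
  by rewrite inE /=; apply/negP => /mapP[].
case: (x < y)%N; case: (y < z)%N => //; by rewrite [all _ (_ :: _)]/= ?n1.
Qed.

Lemma refines_cons2_1 e x : refines (2%N :: e) (run_lengths [:: x]) = false.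
Proof. by rewrite /refines sumn_run_lengths !andbF. Qed.

(** Padding with zeros embeds these compositions in the [N]-tuples with entries at most [N]. This
    turns the finitely supported sum in [fundamental_qsym] into an actual finite sum. *)
Lemma finite_compositions N : finite_set [set b | is_composition b /\ sumn b = N].
Proof.
pose f (u : N.-tuple 'I_N.+1) : seq nat := [seq k <- map val u | (0 < k)%N].
apply: (@sub_finite_set _ _ (f @` [set: N.-tuple 'I_N.+1])); last exact/finite_image/finite_finset.
move=> b [cb sb].
have szb : (size b <= N)%N.
  rewrite -sb; elim: b cb {sb} => //= k b IH /andP[k0 /IH le].
  by rewrite -add1n leq_add.
have le_b k : k \in b -> (k < N.+1)%N.
  by move=> kb; rewrite ltnS -sb (perm_sumn (perm_to_rem kb)) leq_addr.
pose s := b ++ nseq (N - size b) 0%N.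
have ss : size [seq inord k : 'I_N.+1 | k <- s] == N.
  by rewrite size_map size_cat size_nseq subnKC.
exists (Tuple ss) => //; rewrite /f -map_comp /s map_cat filter_cat.
have -> : [seq (val \o (inord : nat -> 'I_N.+1)) k | k <- b] = b.
  by rewrite -[RHS]map_id; apply/eq_in_map => k /le_b kN /=; rewrite inordK.
have -> : [seq k <- b | (0 < k)%N] = b by apply/all_filterP.
rewrite -[RHS]cats0; congr (_ ++ _); rewrite map_nseq /= inordK //.
by elim: (N - size b)%N.
Qed.

Lemma fundamental_qsymE a m : fundamental_qsym a m = (refines (exponents m) a)%:R.
Proof.
rewrite /fundamental_qsym; set A := [set b | refines b a]%classic.
have finA : finite_set A.
  apply: sub_finite_set (finite_compositions (sumn a)) => b.
  by rewrite /A /= => /and4P[cb _ /eqP sb _].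
rewrite fsbig_finite // fct_sumE /monomial_qsym.
have memA b : (b \in fset_set A) = refines b a 
    by rewrite in_fset_set //; apply/idP/idP => [/set_mem|? ]; [exact | exact/mem_set].
case: (boolP (refines (exponents m) a)) => [ref|nref].
  rewrite (bigD1_seq (exponents m)) ?memA ?fset_uniq //= eqxx big1 ?addr0 // => b.
  by rewrite eq_sym => /negPf ->.
rewrite big_seq big1 // => b; rewrite memA => ref.
by case: eqP => // mE; rewrite mE ref in nref.
Qed.

Lemma composition12 e : all [in [:: 1%N; 2%N]] e -> is_composition e.
Proof. by apply: sub_all => k; rewrite !inE => /orP[] /eqP ->. Qed.

Section WordSums.
Variable E : eqType.
Implicit Types (t s : seq E) (w : E -> nat).

Definition run_coef w (e : seq nat) s : rat := (refines e (run_lengths (map w s)))%:R.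

Lemma sum_permutations t (G : seq E -> rat) : uniq t -> t != [::] ->
  \sum_(s <- permutations t) G s =
  \sum_(x <- t) \sum_(s <- permutations (rem x t)) G (x :: s).
Proof.
move=> ut t0; have sz : (0 < size t)%N by case: t t0 {ut}.
by rewrite (perm_big _ (permutationsE sz)) big_allpairs_dep /= undup_id.
Qed.

Lemma sum_permutations1 t w e (P : seq E -> rat) : uniq t -> is_composition e ->
  \sum_(s <- permutations t) P s * run_coef w (1%N :: e) s =
  \sum_(x <- t) \sum_(s <- permutations (rem x t)) P (x :: s) * run_coef w e s.
Proof.
move=> ut ce; have [->|t0] := eqVneq t [::].
  by rewrite !big_cons !big_nil /run_coef refines_run_nil // mulr0 addr0.
rewrite sum_permutations //; apply: eq_bigr => x _; apply: eq_bigr => s _.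
by rewrite /run_coef /= refines_cons1.
Qed.

Lemma sum_permutations2 t w e (P : seq E -> rat) : uniq t -> is_composition e ->
  \sum_(s <- permutations t) P s * run_coef w (2%N :: e) s =
  \sum_(x <- t) \sum_(y <- rem x t) \sum_(s <- permutations (rem y (rem x t)))
    P [:: x, y & s] * ((w x < w y)%N%:R * run_coef w e s).
Proof.
move=> ut ce; have [->|t0] := eqVneq t [::].
  by rewrite !big_cons !big_nil /run_coef refines_run_nil // mulr0 addr0.
rewrite sum_permutations //; apply: eq_bigr => x _.
have [->|tx0] := eqVneq (rem x t) [::].
  by rewrite !big_cons !big_nil /run_coef refines_cons2_1 mulr0 addr0.
rewrite sum_permutations ?rem_uniq //; apply: eq_bigr => y _; apply: eq_bigr => s _.
by rewrite /run_coef /= refines_cons2 // -mulnb natrM.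
Qed.

Lemma sum_pairs_lt t w : uniq t -> injective w ->
  \sum_(x <- t) \sum_(y <- rem x t) (w x < w y)%N%:R = 'C(size t, 2)%:R :> rat.
Proof.
move=> + inj_w; elim: t => [|x t IH] /=; first by rewrite big_nil.
move=> /andP[xt ut]; rewrite big_cons /= eqxx.
have -> : \sum_(j <- t) \sum_(y <- if x == j then t else x :: rem j t) (w j < w y)%N%:R =
    \sum_(j <- t) ((w j < w x)%N%:R + \sum_(y <- rem j t) (w j < w y)%N%:R) :> rat.
  rewrite big_seq [RHS]big_seq; apply: eq_bigr => j jt.
  by case: eqP => [xj|_]; rewrite ?big_cons //; rewrite xj jt in xt.
rewrite big_split /= IH // addrA -big_split /= binS natrD bin1 addrC; congr (_ + _).
rewrite big_seq (eq_bigr (fun=> 1)) => [|y yt].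
  by rewrite -big_seq big_const_seq count_predT iter_addr addr0.
have /negPf nxy : x != y by apply: contraNneq xt => ->.
by case: ltngtP => [||/inj_w/eqP]; rewrite ?addr0 ?add0r // nxy.
Qed.

(** With no order relation a block may consist of any letters, in their unique increasing order;
    this is the case of a matroid of loops. *)
Lemma sum_run_coef t w e : uniq t -> injective w -> all [in [:: 1%N; 2%N]] e ->
  \sum_(s <- permutations t) run_coef w e s = rank0 (size t) e.
Proof.
move=> + inj_w; elim: e t => [|k e IH] t ut.
  move=> _; rewrite /rank0 /=; case: t ut => [|x t] ut; first by rewrite big_seq1.
  rewrite big_seq big1 // => s; rewrite mem_permutations => /perm_size.
  by case: s => // y s _; rewrite /run_coef refines_nil_run.
rewrite [all _ _]/= => /andP[k12 e12]; have ce := composition12 e12.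
under eq_bigr do rewrite -[run_coef _ _ _]mul1r.
move: k12; rewrite !inE => /orP[] /eqP ->.
  rewrite (sum_permutations1 w (fun=> 1)) // /rank0 /= bin1 subn1.
  rewrite big_seq (eq_bigr (fun=> rank0 (size t).-1 e)) => [|x xt].
    by rewrite -big_seq big_const_seq count_predT iter_addr addr0 [RHS]mulr_natl.
  by under eq_bigr do rewrite mul1r; rewrite IH ?rem_uniq // size_rem.
rewrite (sum_permutations2 w (fun=> 1)) // /rank0 /= -(sum_pairs_lt ut inj_w).
rewrite mulr_suml big_seq [RHS]big_seq; apply: eq_bigr => x xt.
rewrite mulr_suml big_seq [RHS]big_seq; apply: eq_bigr => y yt.
under eq_bigr do rewrite mul1r; rewrite -mulr_sumr IH ?rem_uniq //.
by rewrite !size_rem // subn2.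
Qed.

End WordSums.

(** * Linear extensions after the first basis element *)

Section FirstOut.
Variables (E : eqType) (out : pred E).
Implicit Types (t s : seq E).

(** For a basis formed by the removed first letter and [y], this is what remains of the linear
    extension condition, with [out] the complement of the class of the first letter. *)
Fixpoint first_out (y : E) (s : seq E) : bool :=
  if s is z :: s' then if out z then z == y else first_out y s' else false.

Lemma first_outP y s : y \in s -> out y ->
  reflect (forall b, out b -> b != y -> (index y s < index b s)%N) (first_out y s).
Proof.
move=> + outy; elim: s => //= z s IH; rewrite inE.
case: (boolP (out z)) => [outz|noutz].
  move=> _; apply: (iffP eqP) => [-> b _|lt]; first by rewrite eqxx eq_sym => /negPf ->.
  by apply/eqP; apply: contraT => /(lt z outz); rewrite eqxx.
have nzy b : out b -> (z == b) = false by apply: contraTF => /eqP <-.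
rewrite eq_sym nzy //= => /IH{IH} IH.
by apply: (iffP IH) => lt b outb by_; have := lt b outb by_; rewrite !nzy // ltnS.
Qed.

Lemma filter_rem (a : pred E) x t : uniq t ->
  [seq y <- rem x t | a y] = rem x [seq y <- t | a y].
Proof.
move=> ut; rewrite !rem_filter ?filter_uniq // -!filter_predI.
by apply: eq_filter => y /=; rewrite andbC.
Qed.

(** The labelling varies with the second basis element [y], which gets the top label on [D]; the
    order [w0] of the other labels does not vary. In the application [D] excludes the first
    letter. *)
Variables (D : pred E) (w : E -> E -> nat) (w0 : E -> nat).
Hypotheses (inj_w : forall y, injective (w y)) (inj_w0 : injective w0).
Hypothesis w_top : forall y u, D u -> u != y -> (w y u < w y y)%N.
Hypothesis w_out : forall y u v, D u -> D v -> u != y -> v != y ->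
  (w y u < w y v)%N = (w0 u < w0 v)%N.

Definition first_sum t e : rat :=
  \sum_(y <- t | out y) \sum_(s <- permutations t)
    (first_out y s)%:R * run_coef (w y) e s.

Let inn := predC out.

Lemma sum_first_out t z (G : E -> rat) : out z -> z \in t -> uniq t ->
  \sum_(y <- t | out y) (z == y)%:R * G y = G z.
Proof.
move=> outz zt ut; rewrite -big_filter (bigD1_seq z) ?filter_uniq ?mem_filter ?outz //=.
by rewrite eqxx mul1r big1 ?addr0 // => y; rewrite eq_sym => /negPf ->; rewrite mul0r.
Qed.

Lemma big_out_rem t z (G : E -> rat) : ~~ out z -> uniq t ->
  \sum_(y <- rem z t | out y) G y = \sum_(y <- t | out y) G y.
Proof.
move=> noutz ut; rewrite -big_filter -[RHS]big_filter filter_rem // rem_id // mem_filter.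
by rewrite (negPf noutz).
Qed.

Lemma count_rem_pred (a : pred E) x t : x \in t -> 
  count a (rem x t) = (count a t - a x)%N.
Proof. by move=> xt; rewrite count_rem xt. Qed.

Lemma count_in_out t : (count inn t + count out t)%N = size t.
Proof. by rewrite addnC count_predC. Qed.

Lemma first_sum1 t e : uniq t -> all [in [:: 1%N; 2%N]] e ->
  first_sum t (1%N :: e) =
  \sum_(z <- t | ~~ out z) first_sum (rem z t) e +
  (count out t)%:R * rank0 (size t).-1 e.
Proof.
move=> ut e12; have ce := composition12 e12.
rewrite /first_sum; under eq_bigr do rewrite sum_permutations1 //.
rewrite exchange_big /= (bigID out) /= addrC; congr (_ + _).
  apply: eq_bigr => z noutz.
  rewrite big_out_rem //; apply: eq_bigr => y _; apply: eq_bigr => s _.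
  by rewrite (negPf noutz).
rewrite -sum1_count natr_sum mulr_suml big_seq_cond [RHS]big_seq_cond.
apply: eq_bigr => z /andP[zt outz]; rewrite outz mul1r -(size_rem zt).
under eq_bigr do rewrite -mulr_sumr.
by rewrite sum_first_out // sum_run_coef ?rem_uniq.
Qed.

(** The two ascending letters are both inside, or an inside letter followed by [y], which always
    ascends because of its top label. A first letter outside would be [y], and a descent would
    follow. *)
Lemma first_sum2 t e : uniq t -> all D t -> all [in [:: 1%N; 2%N]] e ->
  first_sum t (2%N :: e) =
  \sum_(z <- t | ~~ out z) \sum_(z' <- rem z t | ~~ out z')
    (w0 z < w0 z')%N%:R * first_sum (rem z' (rem z t)) e +
  (count inn t)%:R * (count out t)%:R * rank0 (size t - 2) e.
Proof.
move=> ut /allP Dt e12; have ce := composition12 e12.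
rewrite /first_sum; under eq_bigr do rewrite sum_permutations2 //.
rewrite exchange_big /= (bigID out) /= big_seq_cond big1 ?add0r => [|z /andP[zt outz]].
  rewrite -[count inn t]sum1_count natr_sum -mulrA mulr_suml -big_split /=.
  rewrite big_seq_cond [RHS]big_seq_cond; apply: eq_bigr => z /andP[zt noutz].
  have ut' : uniq (rem z t) by rewrite rem_uniq.
  rewrite exchange_big /= (bigID out) /= addrC; congr (_ + _).
    rewrite big_seq_cond [RHS]big_seq_cond; apply: eq_bigr => z' /andP[z't noutz'].
    rewrite mulr_sumr big_out_rem // big_out_rem //; apply: eq_bigr => y outy.
    rewrite mulr_sumr; apply: eq_bigr => s _.
    have neq u : ~~ out u -> u != y by apply: contraNneq => ->.
    rewrite (negPf noutz) (negPf noutz') w_out ?neq ?Dt // ?(mem_rem z't) //.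
    by rewrite mulrCA.
  have cE : count out t = count out (rem z t).
    by rewrite count_rem_pred // (negPf noutz) subn0.
  rewrite mul1r cE -sum1_count natr_sum mulr_suml big_seq_cond [RHS]big_seq_cond.
  apply: eq_bigr => z' /andP[z't outz']; rewrite (negPf noutz) outz' mul1r.
  under eq_bigr do rewrite -mulr_sumr.
  rewrite sum_first_out ?(mem_rem z't) // -mulr_sumr sum_run_coef ?rem_uniq //.
  rewrite !size_rem // -subn2 w_top ?mul1r ?Dt //.
  by apply: contraNneq noutz => ->.
rewrite exchange_big /= big_seq big1 // => z' z't; rewrite outz.
under eq_bigr do rewrite -mulr_sumr.
rewrite sum_first_out // -mulr_sumr ltnNge ltnW ?mul0r // w_top ?Dt ?(mem_rem z't) //.
by apply: contraTneq z't => ->; rewrite mem_rem_uniqF.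
Qed.

(** Both sides obey one recursion: the lowest block consists of inside letters, or of [y] with
    inside letters, after which nothing is constrained. The predecessor in [rank1_coef] would be
    wrong for an empty block, which words over 1 and 2 exclude. *)
Lemma first_sumE t e : uniq t -> all D t -> all [in [:: 1%N; 2%N]] e ->
  first_sum t e = rank1 (count inn t) (count out t) e.
Proof.
elim: e t => [|k e IH] t ut Dt.
  move=> _; rewrite /first_sum /rank1 /= big1_seq // => y /andP[_ yt].
  rewrite big_seq big1 // => s; rewrite mem_permutations => /perm_size.
  by case: s yt => [|z s]; [case: t {ut Dt} | rewrite /run_coef refines_nil_run mulr0].
rewrite [all _ (_ :: _)]/= => /andP[k12 e12].
have Drem z s : all D s -> all D (rem z s).
  by move=> /allP Ds; apply/allP => u /mem_rem /Ds.
have sumE (I : eqType) (r : seq I) (P : pred I) (F : I -> rat) c :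
    (forall i, i \in r -> P i -> F i = c) -> \sum_(i <- r | P i) F i = (count P r)%:R * c.
  move=> Fc; rewrite -sum1_count natr_sum mulr_suml big_seq_cond [RHS]big_seq_cond.
  by apply: eq_bigr => i /andP[ir Pi]; rewrite mul1r Fc.
move: k12; rewrite !inE => /orP[] /eqP ->.
  rewrite first_sum1 // (sumE _ _ _ _ (rank1 (count inn t).-1 (count out t) e)).
    by rewrite -(count_in_out t) /rank1 /= bin1 bin0 mul1r !subn1.
  move=> z zt noutz; rewrite IH ?rem_uniq ?Drem // !count_rem_pred //.
  by rewrite /inn /= (negPf noutz) subn0 subn1.
rewrite first_sum2 // /rank1 /= -(count_in_out t) bin1.
congr (_ + _); rewrite -size_filter -(sum_pairs_lt _ inj_w0) ?filter_uniq //.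
rewrite big_filter mulr_suml big_seq_cond [RHS]big_seq_cond.
apply: eq_bigr => z /andP[zt noutz].
rewrite -filter_rem // big_filter mulr_suml big_seq_cond [RHS]big_seq_cond.
apply: eq_bigr => z' /andP[z't noutz']; congr (_ * _).
rewrite IH ?rem_uniq ?Drem // !count_rem_pred //.
by rewrite /inn /= (negPf noutz) (negPf noutz') !subn0 -subnDA size_filter.
Qed.

End FirstOut.

(** * The generating function of a rank two matroid *)

Section RankTwoCoefficients.
Variables (E : finType) (T : eqType) (c : E -> T) (M : matroid E).
Hypothesis bases_pair : forall x y, ([set x; y] \in bases M) = (c x != c y).
Hypothesis bases_card2 : forall B, B \in bases M -> exists x y, B = [set x; y].

Let outside (x : E) : pred E := fun y => c y != c x.

Let label (x y : E) : E -> nat := basis_label [set x; y].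

Lemma label_inj x y : injective (label x y).
Proof. by have [] := basis_label_strict M [set x; y]. Qed.

Lemma label_top x y u v : u \in [set x; y] -> v \notin [set x; y] ->
  (label x y v < label x y u)%N.
Proof.
move=> uxy /negPf vxy; rewrite /label /basis_label uxy vxy mul0n mul1n add0n ltnS.
by rewrite (leq_trans (ltn_ord _)) ?leq_addr.
Qed.

Lemma label_same x y u v : (u \in [set x; y]) = (v \in [set x; y]) ->
  (label x y u < label x y v)%N = (enum_rank u < enum_rank v)%N.
Proof. by rewrite /label /basis_label => ->; rewrite ltnS ltn_add2l. Qed.

(** An [x] outside [B] differs in colour from one element of [B], hence can replace the other one,
    which then lies below [x]. *)
Lemma linear_extension_head B x s : B \in bases M ->
  is_linear_extension (basis_poset M B) (x :: s) -> x \in B.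
Proof.
move=> BM /andP[_ /forallP ext]; apply: contraT => xB.
have [a [b BE]] := bases_card2 BM.
have cab : c a != c b by rewrite -bases_pair -BE.
have cover u v : B = [set u; v] -> c x != c v -> false.
  move=> BE' cxv.
  have uv : u != v.
    by apply/eqP => uv; move: BM; rewrite BE' uv bases_pair eqxx.
  have /forallP/(_ x)/implyP := ext u.
  rewrite /basis_poset xB BE' set21 /= eqxx ltn0; apply.
  suff -> : x |: [set u; v] :\ u = [set x; v] by rewrite bases_pair.
  by apply/setP => z; rewrite !inE; case: (eqVneq z u) => //= ->; rewrite (negPf uv).
have [cxb|cxb] := eqVneq (c x) (c b); last exact: cover BE cxb.
by apply: (cover b a); [rewrite BE finset.setUC | rewrite cxb eq_sym].
Qed.

(** Relations above [x] hold because [x] comes first; an element outside the basis lies above [y]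
    exactly when its colour differs from that of [x]. *)
Lemma linear_extension_cons x y s : x :: s \in permutations (enum E) -> outside x y ->
  is_linear_extension (basis_poset M [set x; y]) (x :: s) = first_out (outside x) y s.
Proof.
rewrite mem_permutations /is_linear_extension => xs outy; rewrite xs /=.
have neq_out z : outside x z -> x == z = false.
  by apply: contraNF => /eqP ->.
have ys : y \in s.
  have : y \in x :: s by rewrite (perm_mem xs) mem_enum.
  by rewrite inE eq_sym neq_out.
have yx : y != x by rewrite eq_sym neq_out.
have poset_y b : b != x -> b != y -> basis_poset M [set x; y] y b = outside x b.
  move=> bx by_; rewrite /basis_poset !inE eqxx orbT (negPf bx) (negPf by_) /=.
  suff -> : b |: [set x; y] :\ y = [set b; x] by rewrite bases_pair.
  apply/setP => z; rewrite !inE.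
  by case: (eqVneq z y) => [->|_] /=; rewrite ?(negPf yx) ?orbF.
apply/forallP/first_outP => // [ext b outb by_|lt_y a].
  have bx : b != x by rewrite eq_sym neq_out.
  have /forallP/(_ b) := ext y; rewrite poset_y // outb /=.
  by rewrite !neq_out // ltnS.
apply/forallP => b; apply/implyP => /[dup] ab /and3P[]; rewrite !inE negb_or.
move=> /orP[] /eqP aE /andP[bx by_] _.
  by rewrite aE eqxx [x == b]eq_sym (negPf bx).
rewrite aE neq_out // [x == b]eq_sym (negPf bx) ltnS.
apply: (lt_y b _ by_).
by move: ab; rewrite aE poset_y.
Qed.

Lemma sum_bases_containing x (G : {set E} -> rat) :
  \sum_(B in bases M | x \in B) G B = \sum_(y | outside x y) G [set x; y].
Proof.
rewrite -(big_imset (h := fun y => [set x; y])) /=; last first.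
  move=> y z outy _ /setP/(_ y); rewrite !inE eqxx orbT.
  case: (eqVneq y x) => [yx|_]; first by move: outy; rewrite yx unfold_in eqxx.
  by move=> /esym/eqP.
apply: eq_bigl => B; apply/andP/imsetP => [[BM]|[y outy ->]]; last first.
  by split; [rewrite bases_pair eq_sym | exact: set21].
have [a [b BE]] := bases_card2 BM; move: BM; rewrite BE bases_pair !inE => cab.
move=> /orP[] /eqP ->; first by exists b; rewrite ?unfold_in 1?eq_sym.
by exists a; rewrite ?unfold_in // finset.setUC.
Qed.

Lemma F_matroid_words e : all [in [:: 1%N; 2%N]] e ->
  coef_word (F_matroid M) e =
  \sum_(s <- permutations (enum E))
    \sum_(B in bases M | is_linear_extension (basis_poset M B) s)
      run_coef (basis_label B) e s.
Proof.
move=> e12; rewrite /coef_word /F_matroid fct_sumE (exchange_big_dep (mem (bases M))) => [|? ? _ /andP[]] //=.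
apply: eq_bigr => B BM; rewrite /F_poset fct_sumE big_mkcond [RHS]big_mkcond.
apply: eq_bigr => s _; rewrite BM /=; case: ifP => // _.
rewrite fundamental_qsymE exponents_monom (_ : [seq k <- e | _] = e) //.
by apply/all_filterP; exact: composition12.
Qed.

Lemma big_outside x (G : E -> rat) :
  \sum_(y | outside x y) G y = \sum_(y <- rem x (enum E) | outside x y) G y.
Proof.
by rewrite big_out_rem ?enum_uniq ?big_enum_cond // /outside negbK.
Qed.

Lemma enum_neq_nil : enum E != [::].
Proof.
have /set0Pn[B /bases_card2[x _]] := bases_neq0 M.
by apply: contraTneq (mem_enum E x) => ->.
Qed.

Lemma F_matroid_first e : all [in [:: 1%N; 2%N]] e ->
  coef_word (F_matroid M) e =
  \sum_x \sum_(y <- rem x (enum E) | outside x y)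
    \sum_(s <- permutations (rem x (enum E)))
      (first_out (outside x) y s)%:R * run_coef (label x y) e (x :: s).
Proof.
move=> e12; rewrite F_matroid_words // sum_permutations ?enum_uniq ?enum_neq_nil //.
rewrite big_enum /=; apply: eq_bigr => x _; rewrite -big_outside exchange_big /=.
rewrite big_seq [RHS]big_seq; apply: eq_bigr => s; rewrite mem_permutations => sx.
have xs : x :: s \in permutations (enum E).
  by rewrite mem_permutations perm_sym (permPl (perm_to_rem (mem_enum E x))) perm_cons perm_sym.
transitivity (\sum_(B in bases M | x \in B)
   (is_linear_extension (basis_poset M B) (x :: s))%:R * run_coef (basis_label B) e (x :: s)).
  rewrite [LHS]big_mkcondr [RHS]big_mkcondr; apply: eq_bigr => B BM.
  case: (boolP (is_linear_extension _ _)) => ext; rewrite ?mul1r ?mul0r ?if_same //.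
  by rewrite (linear_extension_head BM ext).
rewrite sum_bases_containing; apply: eq_bigr => y outy.
by rewrite linear_extension_cons.
Qed.

Let class_size x := #|[pred y | c y == c x]|.

Lemma count_outside x : count (outside x) (rem x (enum E)) = (#|E| - class_size x)%N.
Proof.
rewrite count_rem_pred ?mem_enum // /outside eqxx subn0 -sum1_count big_enum_cond sum1_card.
by rewrite -(cardC [pred y | c y == c x]) addKn; apply: eq_card.
Qed.

(** A first block of one element [x] leaves the contraction by [x], where the [p - 1] elements
    parallel to [x] are loops. A first block of two must be a basis, and nothing is constrained
    afterwards. *)
Lemma F_matroid_rank2 t :
    (forall phi : nat -> rat,
      \sum_(p <- t) p%:R * phi p = \sum_x phi (class_size x)) ->
  agree12 (coef_word (F_matroid M)) (rank2 #|E| t).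
Proof.
move=> sum_t e e12; rewrite F_matroid_first //.
have class_le x : (0 < class_size x <= #|E|)%N.
  by rewrite max_card andbT; apply/card_gt0P; exists x; rewrite inE.
have size_r x : size (rem x (enum E)) = #|E|.-1 by rewrite size_rem ?mem_enum // -cardE.
have in_r x z : z \in rem x (enum E) -> z != x.
  by apply: contraTneq => ->; rewrite mem_rem_uniqF ?enum_uniq.
have out_neq x y : outside x y -> y != x.
  by apply: contraTneq => ->; rewrite /outside eqxx.
case: e e12 => [|k e].
  move=> _; rewrite big1 // => x _; rewrite big1 // => y _; rewrite big1 // => s _.
  by rewrite /run_coef refines_nil_run mulr0.
rewrite [all _ (_ :: _)]/= => /andP[k12 e12]; have ce := composition12 e12.
move: k12; rewrite !inE => /orP[] /eqP ->.
  rewrite /rank2 (sum_t (fun p => rank1 p.-1 (#|E| - p) e)); apply: eq_bigr => x _.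
  transitivity (first_sum (outside x) (label x) (rem x (enum E)) e).
    apply: eq_bigr => y _; apply: eq_bigr => s _.
    by rewrite /run_coef /= refines_cons1.
  rewrite (@first_sumE _ _ (predC1 x) _ (fun u : E => enum_rank u)) ?rem_uniq ?enum_uniq //.
  - have := count_in_out (outside x) (rem x (enum E)).
    rewrite size_r count_outside => sumE.
    have /andP[c0 cE] := class_le x; congr (rank1 _ _ e).
    move: sumE c0 cE; move: (count _ _) (class_size x) #|E| => a b N sE b0 bN.
 lia.
  - exact: label_inj.
  - by move=> u v /val_inj/enum_rank_inj.
  - by move=> y u ux uy; apply: label_top; rewrite ?set22 // !inE negb_or uy andbT.
  - move=> y u v ux vx uy vy; apply: label_same.
    by rewrite !inE (negPf ux) (negPf vx) (negPf uy) (negPf vy).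
  by apply/allP => u /in_r.
transitivity (\sum_x \sum_(z | outside x z)
    (enum_rank x < enum_rank z)%N%:R * rank0 (#|E| - 2) e).
  apply: eq_bigr => x _.
  have [r0|rn0] := eqVneq (rem x (enum E)) [::].
    by rewrite big_outside r0 !big_nil.
  under eq_bigr do rewrite sum_permutations ?rem_uniq ?enum_uniq //.
  rewrite exchange_big big_outside [RHS]big_mkcond big_seq [RHS]big_seq.
  apply: eq_bigr => z zr.
  (* A second letter parallel to [x] lies outside the basis and would give a descent; one outside
     the class of [x] must be [y]. *)
  have step y s : outside x y -> (first_out (outside x) y (z :: s))%:R *
      run_coef (label x y) (2%N :: e) [:: x, z & s] =
      (outside x z)%:R * ((z == y)%:R *
      ((enum_rank x < enum_rank z)%N%:R * run_coef (label x z) e s)).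
    move=> outy; rewrite /run_coef [map _ _]/= refines_cons2 // -mulnb natrM /=.
    case: ifP => outz; last first.
      rewrite mul0r ltnNge ltnW ?mul0r ?mulr0 //; apply: label_top; rewrite ?set21 //.
      rewrite !inE (negPf (in_r _ _ zr)) /=.
      by apply: contraFneq outz => ->.
    rewrite mul1r; case: eqP => [->|_]; rewrite ?mul0r // !mul1r.
    by congr ((nat_of_bool _)%:R * _); apply: label_same; rewrite set21 set22.
  under eq_bigr => y outy.
    under eq_bigr do rewrite step //.
    rewrite -!mulr_sumr.
  over.
  rewrite /= -mulr_sumr; case: ifP => outz; rewrite ?mul0r // mul1r.
  rewrite sum_first_out ?rem_uniq ?enum_uniq // sum_run_coef ?rem_uniq ?enum_uniq //.
    by rewrite size_rem // size_r subn2.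
  exact: label_inj.
under eq_bigr do rewrite -mulr_suml.
rewrite -mulr_suml /rank2; congr (_ * _).
rewrite (sum_t (fun p => (#|E| - p)%:R)).
(* Exchanging the roles of [x] and [z] shows that ascents and descents between different classes are
   equally many; this accounts for the division by two. *)
set S := LHS; have SE : S = \sum_x \sum_(z | outside x z) (enum_rank z < enum_rank x)%N%:R.
  rewrite /S (exchange_big_dep xpredT) //=; apply: eq_bigr => x _; apply: eq_bigl => z.
  by rewrite /outside eq_sym.
suff : S + S = \sum_x (#|E| - class_size x)%:R by lra.
rewrite {2}SE -big_split; apply: eq_bigr => x _; rewrite -big_split /=.
rewrite -count_outside -sum1_count natr_sum -big_outside; apply: eq_bigr => z outz.
case: ltngtP => // /val_inj/enum_rank_inj xz.
by have := out_neq _ _ outz; rewrite xz eqxx.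
Qed.

End RankTwoCoefficients.

(** * Matroids of rank two *)

Section RankTwoMatroids.
Variables (E : finType) (M : matroid E).

Lemma bases_equicardinal A B : A \in bases M -> B \in bases M -> #|A| = #|B|.
Proof.
suff le : forall A B, A \in bases M -> B \in bases M -> (#|A| <= #|B|)%N.
  by move=> MA MB; apply/eqP; rewrite eqn_leq !le.
move=> {}A {}B; have [m] := ubnP #|A :\: B|; elim: m A => // m IH A; rewrite ltnS => lt_m MA MB.
have [/eqP|[x xAB]] := set_0Vmem (A :\: B).
  by rewrite finset.setD_eq0 => /subset_leq_card.
have [y yBA MA'] := bases_exchange MA MB xAB.
move: xAB yBA; rewrite !inE => /andP[xB xA] /andP[yA yB].
have <- : #|y |: (A :\ x)| = #|A|.
  by rewrite cardsU1 !inE (negPf yA) andbF /= (cardsD1 x A) xA.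
apply: IH => //; apply: leq_trans lt_m.
rewrite [X in (_ < X)%N](cardsD1 x) !inE xB xA ltnS subset_leq_card //.
apply/fintype.subsetP => z; rewrite !inE => /andP[zB /orP[/eqP zy|/andP[zx zA]]].
  by rewrite zy yB in zB.
by rewrite zB zx zA.
Qed.

Hypotheses (M_loopless : loopless M) (M_rank : rank M = 2%N).

Lemma rank2_bases_card B : B \in bases M -> #|B| = 2%N.
Proof.
move=> MB.
have indB C : C \in bases M -> independent M C by move=> MC; apply/exists_inP; exists C.
have le2 C : independent M C -> (#|C| <= 2)%N.
  by move=> iC; rewrite -M_rank /rank; exact: (@leq_bigmax_cond _ _ (fun A : {set E} => #|A|) C iC).
apply/eqP; rewrite eqn_leq le2 ?indB //=.
have [A iA] : {A | independent M A & rank M = #|A|}.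
  by apply: (eq_bigmax_cond (fun A : {set E} => #|A|)); apply/card_gt0P; exists B; apply: indB.
rewrite M_rank => ->; have /exists_inP[C MC AC] := iA.
by rewrite (bases_equicardinal MB MC) subset_leq_card.
Qed.

Lemma parallel_rank2 x y : parallel M x y = ([set x; y] \notin bases M).
Proof.
have nl z : ~~ is_loop M z by move/forallP: M_loopless.
rewrite /parallel !nl /=; case: eqVneq => [->|xy] /=.
  by symmetry; apply/negP => /rank2_bases_card; rewrite finset.setUid cards1.
congr (~~ _); apply/exists_inP/idP => [[B MB sB]|MB]; last by exists [set x; y].
suff -> : [set x; y] = B by [].
by apply/eqP; rewrite eqEcard sB (rank2_bases_card MB) cards2 xy.
Qed.

Lemma parallel_refl : reflexive (parallel M).
Proof.
move=> x; rewrite parallel_rank2; apply/negP => /rank2_bases_card.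
by rewrite finset.setUid cards1.
Qed.

Lemma parallel_sym : symmetric (parallel M).
Proof. by move=> x y; rewrite !parallel_rank2 finset.setUC. Qed.

(** If [x] and [z] formed a basis, exchange with a basis made of [y] and [t] would replace [t] by
    [x] or [z], against one of the hypotheses. *)
Lemma parallel_trans : transitive (parallel M).
Proof.
move=> y x z; rewrite !parallel_rank2 => xy yz; apply/negP => xz.
have : ~~ is_loop M y by move/forallP: M_loopless.
rewrite /is_loop negbK => /exists_inP[B MB]; rewrite finset.sub1set => yB.
have /cards2P[u [v [uv BE]]] : #|B| == 2%N by rewrite rank2_bases_card.
have [t [ty {}BE]] : exists t, t != y /\ B = [set y; t].
  move: yB; rewrite BE !inE => /orP[] /eqP ->; first by exists v; rewrite eq_sym.
  by exists u; rewrite finset.setUC.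
have nt s : s \in [set x; z] -> [set y; s] \notin bases M.
  by rewrite !inE => /orP[] /eqP -> //; rewrite finset.setUC.
case: (boolP (t \in [set x; z])) => [/nt|tn]; first by rewrite -BE MB.
have tB : t \in B :\: [set x; z] by rewrite !inE BE set22 andbT; rewrite !inE in tn.
have [s sxz] := bases_exchange MB xz tB.
have -> : s |: B :\ t = [set y; s].
  apply/setP => r; rewrite BE !inE; case: (eqVneq r t) => [->|_] /=; last by rewrite orbF orbC.
  by rewrite orbF (negPf ty).
by apply/negP/nt; move: sxz; rewrite inE => /andP[].
Qed.

Definition parallel_class (x : E) : {set E} := [set y | parallel M x y].

Lemma parallel_class_eq x y : (parallel_class x == parallel_class y) = parallel M x y.
Proof.
apply/eqP/idP => [/setP/(_ y)|xy]; first by rewrite !inE parallel_refl.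
apply/setP => z; rewrite !inE; apply/idP/idP; apply: parallel_trans => //.
by rewrite parallel_sym.
Qed.

Lemma bases_parallel_class x y :
  ([set x; y] \in bases M) = (parallel_class x != parallel_class y).
Proof. by rewrite parallel_class_eq parallel_rank2 negbK. Qed.

Lemma bases_pairs B : B \in bases M -> exists x y, B = [set x; y].
Proof.
move/rank2_bases_card => cB; have /cards2P[x [y [_ ->]]] : #|B| == 2%N by rewrite cB.
by exists x, y.
Qed.

Lemma sum_class_sizes t (phi : nat -> rat) :
  perm_eq [seq #|C| | C : {set E} <- enum (parallelism_classes M)] t ->
  \sum_(p <- t) p%:R * phi p =
  \sum_x phi #|[pred y | parallel_class y == parallel_class x]|.
Proof.
move=> pt; rewrite -(perm_big _ pt) big_map big_enum.
have classE x : [set y in [set x | ~~ is_loop M x] | parallel M x y] = parallel_class x.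
  by apply/setP => y; rewrite !inE; have /forallP/(_ y) -> := M_loopless.
rewrite [RHS](partition_big parallel_class (mem (parallelism_classes M))) /=; last first.
  move=> x _; rewrite -classE; apply: imset_f.
  by rewrite inE; have /forallP/(_ x) := M_loopless.
apply: eq_bigr => C /imsetP[x _]; rewrite classE => CE.
rewrite (eq_bigr (fun=> phi #|C|)) => [|y /eqP yC].
  rewrite big_const iter_addr addr0 mulr_natl; congr (_ *+ _).
  by apply: eq_card => y; rewrite CE inE unfold_in parallel_sym -parallel_class_eq.
by congr phi; apply: eq_card => z; rewrite -yC !inE parallel_sym -parallel_class_eq.
Qed.

End RankTwoMatroids.

Lemma in_rank2_class_coef n t (M : matroid 'I_n) :
  in_rank2_class t M -> agree12 (coef_word (F_matroid M)) (rank2 n t).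
Proof.
move=> [M_loopless M_rank t_classes]; 
suff : agree12 (coef_word (F_matroid M)) (rank2 #|'I_n| t) by rewrite card_ord.
apply: (F_matroid_rank2 (bases_parallel_class M_loopless M_rank)
  (bases_pairs M_rank)) => phi.
exact: sum_class_sizes.
Qed.

(** * Additive numerical invariants *)

Lemma derivation_eq_mod (J : finType) D (f : series) (g : J -> series) :
  qsym_derivation D -> eq_mod_ideal_sq f (\sum_j g j) ->
  D (coef_word f) [::] = \sum_j D (coef_word (g j)) [::].
Proof.
move=> derD /(derivation_ideal_sq derD); have lin := derivation_linear derD.
have -> : coef_word (f - \sum_j g j) =
    (-1) *: (\sum_j 1 *: coef_word (g j)) + coef_word f.
  rewrite scaleN1r addrC (eq_bigr _ (fun j _ => scale1r (coef_word (g j)))).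
  by apply: funext => e; rewrite /coef_word !fctE !fct_sumE.
rewrite lin (linear_op_sum lin) scaleN1r addrC.
rewrite (eq_bigr _ (fun j _ => scale1r (D (coef_word (g j))))).
by move/eqP; rewrite fct_sumE subr_eq0 => /eqP.
Qed.

Definition imbalance (n : nat) (t : seq nat) (s : nat) : rat :=
  (count_mem s t)%:R - (count_mem (n - s)%N t)%:R.

Lemma imbalance_antisym n t s : (s <= n)%N -> imbalance n t (n - s) = - imbalance n t s.
Proof. by move=> le; rewrite /imbalance subKn // opprB. Qed.

Definition parts_lt (n : nat) (t : seq nat) : bool := all (fun p => (0 < p < n)%N) t.

Lemma composition_parts_lt n t : is_composition t -> sumn t = n -> (2 <= size t)%N ->
  parts_lt n t.
Proof.
move=> ct st szt; apply/allP => p pt; have ptr := perm_to_rem pt.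
have /allP/(_ p pt) -> := ct; rewrite -st (perm_sumn ptr) /= -[X in (X < _)%N]addn0 ltn_add2l.
have : is_composition (rem p t) by apply/allP => q /mem_rem; apply: (allP ct).
have : (0 < size (rem p t))%N by rewrite size_rem //; case: (size t) szt => [|[]].
by case: (rem p t) => // q r _ /andP[q0 _]; rewrite /= addn_gt0 q0.
Qed.

Lemma sum_parts_count n t (f : nat -> rat) : parts_lt n t ->
  \sum_(p <- t) f p = \sum_(1 <= s < n) f s * (count_mem s t)%:R.
Proof.
elim: t => [|p t IH] /=; first by rewrite big_nil big1 // => s _; rewrite mulr0.
move=> /andP[/andP[p0 pn] /IH tE]; rewrite big_cons tE.
under [RHS]eq_bigr do rewrite natrD mulrDr.
rewrite big_split /=; congr (_ + _).
rewrite (bigD1_seq p) ?iota_uniq ?mem_index_iota ?p0 //= eqxx mulr1.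
by rewrite big1 ?addr0 // => s; rewrite eq_sym => /negPf ->; rewrite mulr0.
Qed.

(** The weight [n - 2 s] changes sign when [s] becomes [n - s], so both halves of the imbalance
    contribute the sum of [n - 2 p] over the parts [p]. *)
Lemma sum_imbalance n t : parts_lt n t -> sumn t = n ->
  \sum_(1 <= s < n) (n%:R - 2 * s%:R) * imbalance n t s =
  2 * n%:R * ((size t)%:R - 2).
Proof.
move=> tn st; pose f s : rat := n%:R - 2 * s%:R.
have sum_f : \sum_(1 <= s < n) f s * (count_mem s t)%:R = n%:R * ((size t)%:R - 2).
  rewrite -sum_parts_count // sumrB -mulr_sumr.
  rewrite big_const_seq count_predT iter_addr addr0 -natr_sum -sumnE st.
  by rewrite -mulr_natr; ring.
have rev_f : \sum_(1 <= s < n) f s * (count_mem (n - s)%N t)%:R =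
    - \sum_(1 <= s < n) f s * (count_mem s t)%:R.
  rewrite big_nat_rev /= -sumrN; apply: eq_big_nat => s /andP[s1 sn].
  rewrite add1n subSS subKn ?(ltnW sn) // /f natrB ?(ltnW sn) //; ring.
under eq_bigr do rewrite /imbalance mulrBr -/(f _).
rewrite sumrB rev_f sum_f; ring.
Qed.

Section Imbalance.
Variables (n : nat) (lam : seq nat) (J : finType) (mu : J -> seq nat).
Hypotheses (lam_parts : parts_lt n lam) (lam_sum : sumn lam = n) (n_ge3 : (2 < n)%N).
Hypotheses (mu_parts : forall j, parts_lt n (mu j)) (mu_sum : forall j, sumn (mu j) = n).
Variables (M0 : matroid 'I_n) (N0 : J -> matroid 'I_n).
Hypotheses (M0_class : in_rank2_class lam M0)
  (N0_class : forall j, in_rank2_class (mu j) (N0 j)).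
Hypothesis F_eq : eq_mod_ideal_sq (F_matroid M0) (\sum_(j : J) F_matroid (N0 j)).

Lemma size_additive : (size lam)%:R - 2 = \sum_j ((size (mu j))%:R - 2) :> rat.
Proof.
have n1 : (1 < n)%N by apply: ltnW.
have := derivation_eq_mod (beta_derivation (n - 2)) F_eq.
have -> : beta (n - 2) (coef_word (F_matroid M0)) [::] = ((size lam)%:R - 2) * n`!%:R.
  by rewrite -(beta_rank2_top n1 lam_sum lam_parts); apply: agree12_beta => //; apply: in_rank2_class_coef.
rewrite (eq_bigr (fun j => ((size (mu j))%:R - 2) * n`!%:R)) => [|j _]; last first.
  rewrite -(beta_rank2_top n1 (mu_sum j) (mu_parts j)).
  by apply: agree12_beta => //; apply: in_rank2_class_coef.
rewrite -mulr_suml => /mulIf; apply.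
by rewrite pnatr_eq0 -lt0n fact_gt0.
Qed.

Lemma imbalance_additive_mid s : (1 < s)%N -> (s.+1 < n)%N ->
  imbalance n lam s = \sum_j imbalance n (mu j) s.
Proof.
(* [beta k] lowers degrees by [k + 2], so [s] and [n - s] must both be at least two. *)
move=> s1 sn; pose d := (s - 2)%N; pose e := (n - s - 2)%N.
have dE : s = d.+2 by rewrite /d; lia.
have eE : (n - s)%N = e.+2 by rewrite /e; lia.
have deE : (d.+2 + e.+2 = n)%N by lia.
have der := qsym_derivation_commutator (beta_derivation e) (beta_derivation d).
have agree f g : agree12 f g ->
    commutator (beta e) (beta d) f [::] = commutator (beta e) (beta d) g [::].
  move=> fg; have eq2 i k : beta i (beta k f) [::] = beta i (beta k g) [::].
    by apply: agree12_beta => //; exact: agree12_beta.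
  rewrite [LHS](_ : _ = beta e (beta d f) [::] - beta d (beta e f) [::]) //.
  by rewrite !eq2.
have := derivation_eq_mod der F_eq.
rewrite (agree _ _ (in_rank2_class_coef M0_class)).
rewrite (eq_bigr (fun j => (d.+2`! * e.+2`!)%:R * imbalance n (mu j) s)) => [|j _]; last first.
  by rewrite (agree _ _ (in_rank2_class_coef (N0_class j))) commutator_beta_rank2 // /imbalance eE dE.
rewrite commutator_beta_rank2 // -mulr_sumr /imbalance eE -dE => /mulfI; apply.
by rewrite pnatr_eq0 -lt0n muln_gt0 !fact_gt0.
Qed.

Lemma imbalance_additive s : (0 < s < n)%N ->
  imbalance n lam s = \sum_j imbalance n (mu j) s.
Proof.
move=> s0n; pose delta u : rat := imbalance n lam u - \sum_j imbalance n (mu j) u.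
have delta_mid u : (1 < u)%N -> (u.+1 < n)%N -> delta u = 0.
  by move=> u1 un; rewrite /delta imbalance_additive_mid // subrr.
have delta_anti u : (u <= n)%N -> delta (n - u)%N = - delta u.
  move=> un; rewrite /delta imbalance_antisym //.
  under eq_bigr do rewrite imbalance_antisym //.
  by rewrite sumrN; ring.
have sum_delta : \sum_(1 <= u < n) (n%:R - 2 * u%:R) * delta u = 0.
  under eq_bigr do rewrite /delta mulrBr mulr_sumr.
  rewrite sumrB sum_imbalance // exchange_big /=.
  rewrite (eq_bigr (fun j => 2 * n%:R * ((size (mu j))%:R - 2))) => [|j _].
    by rewrite -mulr_sumr -size_additive subrr.
  by rewrite sum_imbalance.
have delta1 : delta 1%N = 0.
  (* Only [u = 1] and [u = n - 1] remain in the weighted sum; by antisymmetry each contributes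
     [n - 2] times [delta 1]. *)
  move: sum_delta; rewrite big_ltn ?(ltnW n_ge3) //.
  have [m mE] : exists m, n = m.+3 by exists (n - 3)%N; lia.
  rewrite mE big_nat_recr //= big_nat big1 ?add0r => [|u /andP[u1 um]]; last first.
    by rewrite -mE delta_mid ?mulr0 // mE.
  have := delta_anti 1%N (ltnW (ltnW n_ge3)); rewrite mE subn1 /= => ->.
  move=> E; suff : (2 * m.+1%:R : rat) * delta 1%N = 0.
    by move/eqP; rewrite !mulf_eq0 !pnatr_eq0 /= => /eqP.
  by rewrite -E -!natr1; ring.
apply/eqP; rewrite -subr_eq0 -/(delta s); apply/eqP.
have /andP[s0 sn] := s0n.
have [->//|s1] := eqVneq s 1%N.
have [sE|s2] := eqVneq s.+1 n; last by apply: delta_mid; lia.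
have -> : s = (n - 1)%N by lia.
by rewrite delta_anti ?delta1 ?oppr0 //; lia.
Qed.

End Imbalance.

(** * Rank two matroids from colourings *)

Section PairMatroids.
Variables (E : finType) (T : eqType) (L : {set E}) (c : E -> T).

(** When two colours occur outside [L], these are the bases of the matroid with loops [L] and the
    colour classes outside [L] as parallelism classes. Loops arise for the common bases of two
    pieces. *)
Definition pair_bases : {set {set E}} :=
  [set B : {set E} | [exists x, exists y,
    [&& x \notin L, y \notin L, c x != c y & B == [set x; y]]]].

Lemma pair_basesP B : reflect
  (exists x y, [/\ x \notin L, y \notin L, c x != c y & B = [set x; y]])
  (B \in pair_bases).
Proof.
rewrite inE; apply: (iffP existsP) => [[x /existsP[y /and4P[xL yL cxy /eqP BE]]]|].
  by exists x, y.
by move=> [x [y [xL yL cxy ->]]]; exists x; apply/existsP; exists y; rewrite xL yL cxy /=.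
Qed.

Lemma pair_basesE x y :
  ([set x; y] \in pair_bases) = [&& x \notin L, y \notin L & c x != c y].
Proof.
apply/pair_basesP/and3P => [[a [b [aL bL cab xyE]]]|[xL yL cxy]]; last by exists x, y.
have ab : a != b by apply: contraNneq cab => ->.
have : x \in [set a; b] by rewrite -xyE set21.
have : y \in [set a; b] by rewrite -xyE set22.
have nxy : x != y.
  by apply: contraNneq ab => xy; have := cards2 a b; rewrite -xyE xy finset.setUid cards1; case: eqP.
rewrite !inE => /orP[] /eqP yE /orP[] /eqP xE; move: nxy; rewrite yE xE ?eqxx // => _.
by split=> //; rewrite eq_sym.
Qed.

Lemma pair_bases_card B : B \in pair_bases -> #|B| = 2%N.
Proof.
by case/pair_basesP => x [y [_ _ cxy ->]]; rewrite cards2 (contraNneq _ cxy) // => ->.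
Qed.

(** For the exchange axiom: [p] and [q] have different colours, so one of them differs in colour
    from the element that stays. *)
Lemma pair_matroid_exists x y : x \notin L -> y \notin L -> c x != c y ->
  exists M : matroid E, bases M = pair_bases.
Proof.
move=> xL yL cxy.
have neq0 : pair_bases != finset.set0.
  by apply/set0Pn; exists [set x; y]; rewrite pair_basesE xL yL.
suff exch A B z : A \in pair_bases -> B \in pair_bases -> z \in A :\: B ->
    exists2 u, u \in B :\: A & u |: (A :\ z) \in pair_bases by exists (Matroid neq0 exch).
move=> /pair_basesP[a [b [aL bL cab ->]]] /pair_basesP[p [q [pL qL cpq ->]]].
wlog -> : a b aL bL cab / z = a => [thesis|].
  move=> zAB; have := zAB; rewrite !inE => /andP[_ /orP[] /eqP zE].
    exact: (thesis a b).
  have := thesis b a bL aL; rewrite eq_sym cab finset.setUC => th.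
  exact: (th isT zE).
move=> aAB; have aB : a \notin [set p; q] by move: aAB; rewrite inE => /andP[].
have ab : a != b by apply: contraNneq cab => ->.
have new u : u \in [set p; q] -> c u != c b ->
    exists2 u, u \in [set p; q] :\: [set a; b] & u |: ([set a; b] :\ a) \in pair_bases.
  move=> uB cub; have uL : u \notin L by move: uB; rewrite !inE => /orP[] /eqP ->.
  exists u.
    rewrite inE uB andbT !inE negb_or; apply/andP; split.
      by apply: contraNneq aB => <-.
    by apply: contraNneq cub => ->.
  have -> : u |: ([set a; b] :\ a) = [set u; b].
    apply/setP => v; rewrite !inE; case: (eqVneq v a) => [->|_] //=.
    by rewrite (negPf ab) orbF.
  by rewrite pair_basesE uL bL cub.
have [cpb|cpb] := eqVneq (c p) (c b); last by apply: new cpb; rewrite set21.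
by apply: (new q); rewrite ?set22 // -cpb eq_sym.
Qed.

End PairMatroids.

Lemma pair_bases_kernel (E : finType) (T T' : eqType) (L : {set E}) (c : E -> T) (c' : E -> T') :
  (forall x y, (c x == c y) = (c' x == c' y)) -> pair_bases L c = pair_bases L c'.
Proof.
move=> cc'; apply/setP => B; rewrite !inE.
by apply: eq_existsb => x; apply: eq_existsb => y; rewrite cc'.
Qed.

Lemma pair_bases_coarser (E : finType) (T T' : eqType) (L : {set E}) (c : E -> T) (c' : E -> T') :
  (forall x y, c x = c y -> c' x = c' y) -> pair_bases L c' \subset pair_bases L c.
Proof.
move=> cc'; apply/fintype.subsetP => B /pair_basesP[x [y [xL yL cxy ->]]].
by rewrite pair_basesE xL yL; apply: contraNneq cxy => /cc' ->.
Qed.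

(** * Base polytopes *)

Section Cones.
Variables (R : realType) (n : nat).
Implicit Types (F : {set {set 'I_n}}) (x : 'rV[R]_n).
Local Notation vertex := (@basis_vertex R n).

(** Without the normalisation of the weights, points can be added and scaled freely; the polytope is
    the slice with coordinate sum two. *)
Definition bases_cone F x : Prop := exists w : {set 'I_n} -> R,
  (forall B, 0 <= w B) /\ x = \sum_(B in F) w B *: vertex B.

Lemma bases_cone0 F : bases_cone F 0.
Proof. by exists (fun=> 0); split => //; rewrite big1 // => B _; rewrite scale0r. Qed.

Lemma bases_coneD F x y : bases_cone F x -> bases_cone F y -> bases_cone F (x + y).
Proof.
move=> [v [v0 ->]] [w [w0 ->]]; exists (fun B => v B + w B); split.
  by move=> B; rewrite addr_ge0.
by rewrite -big_split; apply: eq_bigr => B _; rewrite scalerDl.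
Qed.

Lemma bases_coneZ F a x : 0 <= a -> bases_cone F x -> bases_cone F (a *: x).
Proof.
move=> a0 [w [w0 ->]]; exists (fun B => a * w B); split.
  by move=> B; rewrite mulr_ge0.
by rewrite scaler_sumr; apply: eq_bigr => B _; rewrite scalerA.
Qed.

Lemma bases_cone_sum F (I : finType) (P : pred I) (f : I -> 'rV[R]_n) :
  (forall i, P i -> bases_cone F (f i)) -> bases_cone F (\sum_(i | P i) f i).
Proof.
by move=> Ff; elim/big_ind: _ => //; [exact: bases_cone0 | exact: bases_coneD].
Qed.

Lemma bases_cone_vertex F B : B \in F -> bases_cone F (vertex B).
Proof.
move=> BF; exists (fun C => (C == B)%:R); split => [C|]; first exact: ler0n.
rewrite (bigD1 B) //= eqxx scale1r big1 ?addr0 // => C /andP[_ /negPf ->].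
by rewrite scale0r.
Qed.

(* Pairing the mass on [P] with the mass on [Q] proportionally turns each pair
   of bases in [P] and [Q] into a pair of bases of [F']. *)
Lemma bases_cone_exchange F F' (P Q : pred {set 'I_n}) (w : {set 'I_n} -> R) :
    (forall B, 0 <= w B) ->
    (forall B, B \in F -> ~~ P B -> B \in F') ->
    (forall B, Q B -> ~~ P B) ->
    (forall B C, B \in F -> C \in F -> P B -> Q C ->
      exists B' C', [/\ B' \in F', C' \in F' &
        vertex B + vertex C = vertex B' + vertex C']) ->
    \sum_(B in F | P B) w B <= \sum_(B in F | Q B) w B ->
  bases_cone F' (\sum_(B in F) w B *: vertex B).
Proof.
move=> w0 FF' QP exch; set WP := \sum_(B in F | P B) w B.
set WQ := \sum_(B in F | Q B) w B => le.
have WP0 : 0 <= WP by apply: sumr_ge0.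
have WQ0 : 0 <= WQ by apply: sumr_ge0.
have wP B : B \in F -> P B -> w B / WQ * WQ = w B.
  (* If [WQ] is zero then so is [WP], and all weights on [P] vanish, which agrees with division by
     zero giving zero. *)
  move=> BF PB; have [WQE|nz] := eqVneq WQ 0; last by rewrite divfK.
  have WPE : WP = 0 by apply/eqP; rewrite eq_le WP0 -WQE le.
  move/eqP: WPE; rewrite psumr_eq0 // => /allP/(_ B (mem_index_enum _)).
  by rewrite BF PB => /eqP ->; rewrite !mul0r.
have -> : \sum_(B in F) w B *: vertex B =
    \sum_(B in F | ~~ P B && ~~ Q B) w B *: vertex B +
    \sum_(B in F | Q B) (w B * (1 - WP / WQ)) *: vertex B +
    \sum_(B in F | P B) \sum_(C in F | Q C)
      (w B * w C / WQ) *: (vertex B + vertex C).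
  rewrite (bigID P) /= addrC (bigID Q) /= [X in X + _ = _]addrC.
  have -> : \sum_(B | (B \in F) && ~~ P B && Q B) w B *: vertex B =
            \sum_(B in F | Q B) w B *: vertex B.
    apply: eq_bigl => B; case: (boolP (Q B)) => [/QP ->|_]; rewrite ?andbT //.
    by rewrite !andbF.
  rewrite -!addrA; congr (_ + _); first by apply: eq_bigl => B; rewrite andbA.
  have -> : \sum_(B in F | P B) \sum_(C in F | Q C)
       (w B * w C / WQ) *: (vertex B + vertex C) =
     \sum_(B in F | P B) w B *: vertex B +
     \sum_(C in F | Q C) (w C * (WP / WQ)) *: vertex C.
    under eq_bigr do under eq_bigr do rewrite scalerDr.
    under eq_bigr do rewrite big_split /=.
    rewrite big_split /=; congr (_ + _).
      apply: eq_bigr => B /andP[BF PB]; rewrite -scaler_suml; congr (_ *: _).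
      rewrite -[RHS](wP B) // mulr_sumr.
      by apply: eq_bigr => C _; rewrite mulrAC.
    rewrite exchange_big /=; apply: eq_bigr => C _; rewrite -scaler_suml; congr (_ *: _).
    rewrite mulr_suml mulr_sumr; apply: eq_bigr => B _; ring.
  rewrite addrCA [RHS]addrC; congr (_ + _).
  rewrite -big_split /=; apply: eq_bigr => C _; rewrite -scalerDl; congr (_ *: _); ring.
apply: bases_coneD; first apply: bases_coneD.
- apply: bases_cone_sum => B /andP[BF /andP[nP _]].
  by apply/bases_coneZ/bases_cone_vertex/FF'.
- apply: bases_cone_sum => B /andP[BF QB].
  apply/bases_coneZ/bases_cone_vertex/FF'/QP => //; apply: mulr_ge0 => //.
  rewrite subr_ge0; have [->|nz] := eqVneq WQ 0; first by rewrite invr0 mulr0.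
  by rewrite ler_pdivrMr ?mul1r // lt_def nz.
apply: bases_cone_sum => B /andP[BF PB]; apply: bases_cone_sum => C /andP[CF QC].
have [B' [C' [B'F C'F ->]]] := exch B C BF CF PB QC.
apply: bases_coneZ; first by rewrite divr_ge0 ?mulr_ge0.
by apply: bases_coneD; apply: bases_cone_vertex.
Qed.

Lemma basis_vertex_set2 i j : i != j -> vertex [set i; j] = delta_mx 0 i + delta_mx 0 j.
Proof. by move=> ij; rewrite /basis_vertex big_setU1 ?inE //= big_set1. Qed.

End Cones.

(* [c1] merges the union [A] of some classes of [c] into one class, [c2] merges
   the complement of [A]. *)
Section Splitting.
Variables (R : realType) (n : nat) (c c1 c2 : 'I_n -> nat) (A : {set 'I_n}).
Hypothesis c1E : forall x y, (c1 x == c1 y) =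
  if (x \in A) && (y \in A) then true
  else if (x \in A) || (y \in A) then false else c x == c y.
Hypothesis c2E : forall x y, (c2 x == c2 y) =
  if (x \in A) && (y \in A) then c x == c y
  else if (x \in A) || (y \in A) then false else true.
Hypothesis cA : forall x y, x \in A -> y \notin A -> c x != c y.

Lemma split_bases B : B \in pair_bases finset.set0 c ->
  (~~ (B \subset A) -> B \in pair_bases finset.set0 c1) /\
  (~~ (B \subset ~: A) -> B \in pair_bases finset.set0 c2).
Proof.
move=> /pair_basesP[x [y [_ _ cxy ->]]].
rewrite !pair_basesE !finset.inE c1E c2E !finset.subUset !finset.sub1set !inE.
by case: (x \in A); case: (y \in A).
Qed.

(** Swapping one element between bases on opposite sides of [A] yields two bases that cross [A],
    with the same vertex sum. *)
Lemma split_vertices B C : B \in pair_bases finset.set0 c -> C \in pair_bases finset.set0 c ->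
    B \subset A -> C \subset ~: A ->
  exists B' C', [/\ B' \in pair_bases finset.set0 c, ~~ (B' \subset A) && ~~ (B' \subset ~: A),
    C' \in pair_bases finset.set0 c, ~~ (C' \subset A) && ~~ (C' \subset ~: A) &
    basis_vertex R B + basis_vertex R C = basis_vertex R B' + basis_vertex R C'].
Proof.
move=> /pair_basesP[x [y [_ _ cxy ->]]] /pair_basesP[u [v [_ _ cuv ->]]].
rewrite !finset.subUset !finset.sub1set !inE => /andP[xA yA] /andP[uA vA].
have neq a b : c a != c b -> a != b by apply: contraNneq => ->.
exists [set x; u], [set y; v]; rewrite !pair_basesE !inE !finset.subUset !finset.sub1set !inE.
rewrite xA yA (negPf uA) (negPf vA) !cA //; split => //.
rewrite (basis_vertex_set2 _ (neq _ _ cxy)) (basis_vertex_set2 _ (neq _ _ cuv)) addrACA.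
by rewrite !basis_vertex_set2 ?neq ?cA.
Qed.

(** Of the mass on bases inside [A] and the mass on bases inside its complement, the smaller can be
    exchanged away completely; which one it is decides the piece. *)
Lemma split_cone x : bases_cone (pair_bases finset.set0 c) x ->
  bases_cone (R := R) (pair_bases finset.set0 c1) x \/
  bases_cone (pair_bases finset.set0 c2) x.
Proof.
move=> [w [w0 ->]].
have excl B : B \in pair_bases finset.set0 c -> B \subset A -> ~~ (B \subset ~: A).
  move=> /pair_basesP[a [b [_ _ _ ->]]].
  by rewrite !finset.subUset !finset.sub1set !inE => /andP[-> _].
pose P (B : {set 'I_n}) := (B \in pair_bases finset.set0 c) && (B \subset A).
pose Q (B : {set 'I_n}) := (B \in pair_bases finset.set0 c) && (B \subset ~: A).
have [le|/ltW le] := leP (\sum_(B in pair_bases finset.set0 c | P B) w B)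
                        (\sum_(B in pair_bases finset.set0 c | Q B) w B); [left | right].
  apply: (bases_cone_exchange w0 _ _ _ le) => [B BF|B|B C BF CF].
  - by rewrite /P BF => /(proj1 (split_bases BF)).
  - move=> /andP[BF BA]; rewrite /P BF /=.
    by apply: contraL BA; apply: excl.
  move=> /andP[_ BA] /andP[_ CA].
  have [B' [C' [B'F /andP[B'A _] C'F /andP[C'A _] E]]] := split_vertices BF CF BA CA.
  by exists B', C'; split; rewrite ?E //; apply: (proj1 (split_bases _)).
apply: (bases_cone_exchange w0 _ _ _ le) => [B BF|B|B C BF CF].
- by rewrite /Q BF => /(proj2 (split_bases BF)).
- by move=> /andP[BF BA]; rewrite /Q BF /= excl.
move=> /andP[_ BA] /andP[_ CA].
have [B' [C' [B'F /andP[_ B'A] C'F /andP[_ C'A] E]]] := split_vertices CF BF CA BA.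
exists B', C'; split; try exact: (proj2 (split_bases _)).
by rewrite addrC E.
Qed.

End Splitting.

(** * Faces and intersections of base polytopes *)

Section Faces.
Variables (R : realType) (n : nat).

Definition dot (u x : 'rV[R]_n) : R := \sum_i u 0 i * x 0 i.

Lemma dot_sum u (I : finType) (P : pred I) (w : I -> R) (v : I -> 'rV[R]_n) :
  dot u (\sum_(i | P i) w i *: v i) = \sum_(i | P i) w i * dot u (v i).
Proof.
rewrite /dot; under [RHS]eq_bigr do rewrite mulr_sumr.
rewrite exchange_big /=; apply: eq_bigr => i _.
rewrite summxE mulr_sumr; apply: eq_bigr => j _; rewrite mxE; ring.
Qed.

Definition indicator (A : {set 'I_n}) : 'rV[R]_n := \row_i (i \in A)%:R.

Lemma dot_indicator_set2 A x y : x != y ->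
  dot (indicator A) (basis_vertex R [set x; y]) = ((x \in A) + (y \in A))%:R.
Proof.
have dot1 z : dot (indicator A) (delta_mx 0 z) = (z \in A)%:R.
  rewrite /dot (bigD1 z) //= big1 ?addr0 => [|i iz]; first by rewrite !mxE !eqxx mulr1.
  by rewrite !mxE eqxx (negPf iz) mulr0.
move=> xy; rewrite basis_vertex_set2 // natrD -!dot1 /dot -big_split /=.
by apply: eq_bigr => i _; rewrite -mulrDr; congr (_ * _); rewrite mxE.
Qed.

Lemma base_polytope_sub (M K : matroid 'I_n) : bases K \subset bases M ->
  (@base_polytope R n K `<=` @base_polytope R n M)%classic.
Proof.
move=> /fintype.subsetP sKM x [w [w0 w1 xE]].
have sum_K (V : nmodType) (f : {set 'I_n} -> V) : \sum_(B in bases M)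
    (if B \in bases K then f B else 0) = \sum_(B in bases K) f B.
  rewrite -big_mkcondr; apply: eq_bigl => B.
  by case: (boolP (B \in bases K)) => [/sKM ->|_]; rewrite ?andbF.
exists (fun B => if B \in bases K then w B else 0); split.
- by move=> B; case: ifP.
- by rewrite sum_K.
by rewrite xE -sum_K; apply: eq_bigr => B _; case: ifP; rewrite ?scale0r.
Qed.

Lemma dot_polytope_le (M : matroid 'I_n) u b x :
  (forall B, B \in bases M -> dot u (basis_vertex R B) <= b) ->
  @base_polytope R n M x -> dot u x <= b.
Proof.
move=> le [w [w0 w1 ->]]; rewrite dot_sum -[leRHS]mul1r -w1 mulr_suml.
by apply: ler_sum => B BM; rewrite ler_wpM2l // le.
Qed.

Lemma dot_polytope_eq (M : matroid 'I_n) u b x :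
  (forall B, B \in bases M -> dot u (basis_vertex R B) = b) ->
  @base_polytope R n M x -> dot u x = b.
Proof.
move=> eqb [w [w0 w1 ->]]; rewrite dot_sum -[RHS]mul1r -w1 mulr_suml.
by apply: eq_bigr => B BM; rewrite eqb.
Qed.

(** On the hyperplane the weighted slacks sum to zero, so vertices with positive slack have weight
    zero. *)
Lemma base_polytope_face (M K : matroid 'I_n) u b :
    (forall B, B \in bases M -> dot u (basis_vertex R B) <= b) ->
    (forall B, (B \in bases K) =
       (B \in bases M) && (dot u (basis_vertex R B) == b)) ->
  @base_polytope R n K = [set x | @base_polytope R n M x /\ dot u x = b]%classic.
Proof.
move=> le KE; apply/seteqP; split=> [x Kx|x [[w [w0 w1 xE]] ux]] /=.
  split; last by apply: dot_polytope_eq Kx => B; rewrite KE => /andP[_ /eqP].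
  by apply: base_polytope_sub Kx; apply/fintype.subsetP => B; rewrite KE => /andP[].
have slack0 B : B \in bases M -> dot u (basis_vertex R B) != b -> w B = 0.
  move=> BM neq.
  have : \sum_(C in bases M) w C * (b - dot u (basis_vertex R C)) = 0.
    under eq_bigr do rewrite mulrBr; rewrite sumrB -mulr_suml w1 mul1r.
    by rewrite -dot_sum -xE ux subrr.
  move/eqP; rewrite psumr_eq0 => [/allP/(_ B (mem_index_enum _))|C CM].
    by rewrite BM mulf_eq0 subr_eq0 [b == _]eq_sym (negPf neq) orbF => /eqP.
  by rewrite mulr_ge0 // subr_ge0 le.
have sum_K (V : nmodType) (f : {set 'I_n} -> V) : (forall B, w B = 0 -> f B = 0) ->
    \sum_(B in bases K) f B = \sum_(B in bases M) f B.
  move=> f0; rewrite (eq_bigl _ _ KE) big_mkcondr; apply: eq_bigr => B BM.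
  by case: ifP => // /negbT /slack0 wB; rewrite f0 // wB.
exists w; split => //; first by rewrite sum_K.
by rewrite xE sum_K // => B ->; rewrite scale0r.
Qed.

Section Intersection.
Variables (M N K : matroid 'I_n) (c d : 'I_n -> nat) (a b : 'I_n).
Hypotheses (ME : bases M = pair_bases finset.set0 c)
  (NE : bases N = pair_bases finset.set0 d) (KE : bases K = bases M :&: bases N).
Hypothesis cover : forall x, c x = c a \/ d x = d b.
Let D := [set x | d x == d b].

(** By [cover] everything outside [D] has colour [c a], so a basis of [M] has at most one element
    there. *)
Lemma cut_le B : B \in bases M -> dot (indicator (~: D)) (basis_vertex R B) <= 1.
Proof.
rewrite ME => /pair_basesP[x [y [_ _ cxy ->]]].
have xy : x != y by apply: contraNneq cxy => ->.
rewrite dot_indicator_set2 // -[leRHS]/(1%:R) ler_nat !inE.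
have [cx|->] := cover x; last by rewrite eqxx; case: (_ == _).
have [cy|->] := cover y; last by rewrite eqxx addn0; case: (_ == _).
by rewrite cx cy eqxx in cxy.
Qed.

(** A basis of [M] meets [D], a colour class of [d]; it is a basis of [N] exactly when it meets [D]
    once. *)
Lemma cut_eq B : (B \in bases K) =
  (B \in bases M) && (dot (indicator (~: D)) (basis_vertex R B) == 1).
Proof.
rewrite KE inE; case: (boolP (B \in bases M)) => //=.
rewrite ME NE => /pair_basesP[x [y [_ _ cxy ->]]].
have xy : x != y by apply: contraNneq cxy => ->.
rewrite dot_indicator_set2 // -[X in _ == X]/(1%:R) eqr_nat pair_basesE !inE /=.
have [cx|dx] := cover x; have [cy|dy] := cover y.
- by rewrite cx cy eqxx in cxy.
- by rewrite dy eqxx addn0; case: (_ == _).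
- by rewrite dx eqxx add0n eq_sym; case: (_ == _).
by rewrite dx dy eqxx.
Qed.

Lemma cut_face : is_face (@base_polytope R n K) (@base_polytope R n M).
Proof.
exists (indicator (~: D)), 1; split.
  by move=> x; apply: dot_polytope_le; apply: cut_le.
exact: base_polytope_face cut_le cut_eq.
Qed.

(** Bases of [N] have at most one element in [D] and the coordinates sum to two, so a common point
    has weight at least one outside [D]; [cut_le] gives the other inequality. *)
Lemma cut_inter :
  (@base_polytope R n M `&` @base_polytope R n N)%classic = @base_polytope R n K.
Proof.
have sKM : bases K \subset bases M by rewrite KE finset.subsetIl.
have sKN : bases K \subset bases N by rewrite KE finset.subsetIr.
apply/seteqP; split=> x; last by move=> Kx; split; apply: base_polytope_sub Kx.
move=> [Mx Nx]; rewrite (base_polytope_face cut_le cut_eq); split => //.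
apply/eqP; rewrite eq_le (dot_polytope_le cut_le) //=.
have leD : dot (indicator D) x <= 1.
  apply: dot_polytope_le Nx => B; rewrite NE => /pair_basesP[y [z [_ _ dyz ->]]].
  have yz : y != z by apply: contraNneq dyz => ->.
  rewrite dot_indicator_set2 // -[leRHS]/(1%:R) ler_nat !inE.
  by move: dyz; case: (d y =P d b) => [->|_]; case: (d z =P d b) => [->|_]; rewrite ?eqxx.
have dotT : dot (indicator finset.setT) x = 2.
  apply: dot_polytope_eq Mx => B; rewrite ME => /pair_basesP[y [z [_ _ cyz ->]]].
  have yz : y != z by apply: contraNneq cyz => ->.
  by rewrite dot_indicator_set2 // !finset.in_setT.
have dotD : dot (indicator finset.setT) x = dot (indicator D) x + dot (indicator (~: D)) x.
  rewrite /dot -big_split; apply: eq_bigr => i _; rewrite !mxE !finset.in_setT !inE /=.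
  by rewrite -mulrDl -natrD; case: (_ == _).
by move: leD; rewrite dotD in dotT; lra.
Qed.

End Intersection.

Lemma polytope_intersection (M N : matroid 'I_n) (c d : 'I_n -> nat) (a b p q : 'I_n) :
    bases M = pair_bases finset.set0 c -> bases N = pair_bases finset.set0 d ->
    (forall x, c x = c a \/ d x = d b) -> c p != c a -> d q != d b ->
  exists K : matroid 'I_n,
    [/\ bases K = bases M :&: bases N,
        (@base_polytope R n M `&` @base_polytope R n N)%classic = @base_polytope R n K,
        is_face (@base_polytope R n K) (@base_polytope R n M)
      & is_face (@base_polytope R n K) (@base_polytope R n N)].
Proof.
move=> ME NE cover cp dq.
(* An element of both covering classes lies in no common basis, so it is a loop of [K]. The others
   form two classes, told apart by [c x == c a]; [p] and [q] show that both are nonempty. *)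
pose L := [set x | (c x == c a) && (d x == d b)].
have [K KE] : exists K : matroid 'I_n, bases K = pair_bases L (fun x => c x == c a).
  apply: (@pair_matroid_exists _ _ _ _ p q); rewrite ?inE ?(negPf cp) ?(negPf dq) ?andbF //.
  by have [->|/eqP] := cover q; [rewrite eqxx | rewrite (negPf dq)].
have KMN : bases K = bases M :&: bases N.
  rewrite KE ME NE; apply/setP => B; rewrite finset.in_setI.
  have pairE x y : ([set x; y] \in pair_bases L (fun x => c x == c a)) =
      ([set x; y] \in pair_bases finset.set0 c) && ([set x; y] \in pair_bases finset.set0 d).
    rewrite !pair_basesE !inE /=.
    have [cx|dx] := cover x; have [cy|dy] := cover y; rewrite ?cx ?cy ?dx ?dy ?eqxx /= ?andbF //.
    - by rewrite andbT [c a == _]eq_sym; case: (c y == c a); case: (d x == d b).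
    - by rewrite andbT [d b == _]eq_sym; case: (c x == c a); case: (d y == d b).
    by case: (c x == c a); case: (c y == c a).
  apply/idP/andP => [|[]] BX; have /pair_basesP[x [y [_ _ _ BE]]] := BX.
    by move: BX; rewrite BE pairE => /andP.
  by move: BX; rewrite BE pairE => -> ->.
exists K; split => //; first exact: cut_inter ME NE KMN cover.
  exact: cut_face ME NE KMN cover.
apply: (cut_face NE ME _ (a := b) (b := a)); first by rewrite KMN finset.setIC.
by move=> x; have [] := cover x; [right | left].
Qed.

End Faces.

(** * Construction of the decomposition *)

Section Colourings.
Variable E : finType.
Implicit Types (c : E -> nat) (t : seq nat).

Definition has_fibres c t : Prop :=
  (forall x, (c x < size t)%N) /\
  (forall i, (i < size t)%N -> #|[set x | c x == i]| = nth 0%N t i).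

Lemma split_set t (A : {set E}) : #|A| = sumn t -> exists g : E -> nat,
  (forall x, x \in A -> (g x < size t)%N) /\
  (forall i, (i < size t)%N -> #|[set x in A | g x == i]| = nth 0%N t i).
Proof.
elim: t A => [|k t IH] A /= cA.
  exists (fun=> 0%N); split => // x xA.
  by move/eqP: cA; rewrite cards_eq0 => /eqP A0; rewrite A0 inE in xA.
pose A1 := [set x in take k (enum A)].
have sA1 : A1 \subset A.
  by apply/fintype.subsetP => x; rewrite inE => /mem_take; rewrite mem_enum.
have cA1 : #|A1| = k.
  rewrite cardsE (card_uniqP _) ?take_uniq ?enum_uniq // size_take -cardE cA.
  by case: ltnP => //; lia.
have cA2 : #|A :\: A1| = sumn t.
  by rewrite cardsD (finset.setIidPr sA1) cA cA1 addKn.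
have [g [g_lt gE]] := IH _ cA2.
exists (fun x => if x \in A1 then 0%N else (g x).+1); split=> [x xA|[|i] lt_i] /=.
- by case: (boolP (x \in A1)) => // xA1; rewrite ltnS g_lt // inE xA1.
- rewrite -[RHS]cA1; apply: eq_card => x; rewrite !inE.
  case: (boolP (x \in take k (enum A))) => xA1; rewrite ?andbF // andbT.
  by apply: (fintype.subsetP sA1); rewrite inE.
rewrite -gE //; apply: eq_card => x; rewrite !inE.
by case: (x \in take k (enum A)); rewrite ?andbF.
Qed.

Lemma has_fibres_exists t : sumn t = #|E| -> exists c, has_fibres c t.
Proof.
move=> st; have [|c [c_lt cE]] := @split_set t [set: E]; first by rewrite cardsT.
exists c; split=> [x|i /cE <-]; first by rewrite c_lt ?inE.
by apply: eq_card => x; rewrite !inE.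
Qed.

Lemma has_fibres_perm c t t' : has_fibres c t -> perm_eq t t' ->
  exists2 c', has_fibres c' t' & forall x y, (c x == c y) = (c' x == c' y).
Proof.
move=> [c_lt cE]; rewrite perm_sym => /(perm_iotaP 0%N)[Is pIs t'E].
have mem_Is i : (i \in Is) = (i < size t)%N by rewrite (perm_mem pIs) mem_iota.
have uIs : uniq Is by rewrite (perm_uniq pIs) iota_uniq.
have sIs : size t' = size Is by rewrite t'E size_map.
exists (fun x => index (c x) Is); last first.
  move=> x y; apply/eqP/eqP => [->//|].
  by move/(congr1 (nth 0%N Is)); rewrite !nth_index ?mem_Is.
split=> [x|i]; first by rewrite sIs index_mem mem_Is.
rewrite sIs => lt_i; rewrite t'E (nth_map 0%N) // -cE; last by rewrite -mem_Is mem_nth.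
apply: eq_card => x; rewrite !inE; apply/eqP/eqP => [<-|->]; last by rewrite index_uniq.
by rewrite nth_index // mem_Is.
Qed.

Lemma has_fibres_surj c t i : has_fibres c t -> is_composition t -> (i < size t)%N ->
  exists x, c x = i.
Proof.
move=> [_ cE] ct lt_i; have : (0 < #|[set x | c x == i]|)%N.
  by rewrite cE //; apply: (allP ct); apply: mem_nth.
by move/card_gt0P=> [x]; rewrite inE => /eqP <-; exists x.
Qed.

Lemma has_fibres_neq c t x : has_fibres c t -> is_composition t -> (1 < size t)%N ->
  exists y, c y != c x.
Proof.
move=> ft ct st; have [cx|cx] := eqVneq (c x) 0%N.
  by have [y cy] := has_fibres_surj ft ct st; exists y; rewrite cy cx.
by have [y cy] := has_fibres_surj ft ct (ltnW st); exists y; rewrite cy eq_sym.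
Qed.

End Colourings.

Lemma pair_matroid_class n (t : seq nat) (c : 'I_n -> nat) (M : matroid 'I_n) :
  bases M = pair_bases finset.set0 c -> has_fibres c t -> is_composition t ->
  (1 < size t)%N -> in_rank2_class t M.
Proof.
move=> ME ft ct st.
have pairE x y : ([set x; y] \in bases M) = (c x != c y).
  by rewrite ME pair_basesE !inE.
have nl x : ~~ is_loop M x.
  have [y cyx] := has_fibres_neq x ft ct st.
  rewrite /is_loop negbK; apply/exists_inP; exists [set x; y]; last by rewrite finset.sub1set set21.
  by rewrite pairE eq_sym.
have loopM : loopless M by apply/forallP.
have rankM : rank M = 2%N.
  rewrite /rank; apply/eqP; rewrite eqn_leq; apply/andP; split.
    apply/bigmax_leqP => A /exists_inP[B BM AB].
    by apply: leq_trans (subset_leq_card AB) _; rewrite (@pair_bases_card _ _ finset.set0 c) -?ME.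
  have /set0Pn[B BM] := bases_neq0 M.
  have <- : #|B| = 2%N by apply: (@pair_bases_card _ _ finset.set0 c); rewrite -ME.
  by apply: (@leq_bigmax_cond _ _ (fun A : {set 'I_n} => #|A|) B); apply/exists_inP; exists B.
split => //.
have parE x y : parallel M x y = (c x == c y).
  by rewrite parallel_rank2 // pairE negbK.
pose fib i := [set x | c x == i].
have [c_lt cE] := ft.
have classE x : [set y in [set x | ~~ is_loop M x] | parallel M x y] = fib (c x).
  by apply/setP => y; rewrite !inE nl parE eq_sym.
have fib_perm : perm_eq (enum (parallelism_classes M)) [seq fib i | i <- iota 0 (size t)].
  apply: uniq_perm; rewrite ?enum_uniq //.
    rewrite map_inj_in_uniq ?iota_uniq // => i j; rewrite !mem_iota /= !add0n => lt_i _ fij.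
    have [x cx] := has_fibres_surj ft ct lt_i.
    by have : x \in fib i by [rewrite inE cx]; rewrite fij inE cx => /eqP.
  move=> C; rewrite mem_enum; apply/imsetP/mapP => [[x _ ->]|[i]].
    by exists (c x); rewrite ?classE // mem_iota c_lt.
  rewrite mem_iota add0n /= => lt_i ->; have [x <-] := has_fibres_surj ft ct lt_i.
  by exists x; rewrite ?classE // inE nl.
rewrite (perm_trans (perm_map (fun C : {set 'I_n} => #|C|) fib_perm)) // -map_comp.
rewrite (_ : [seq _ | i <- _] = t) //; rewrite -[RHS](mkseq_nth 0%N); apply/eq_in_map => i.
by rewrite mem_iota /= => lt_i; rewrite cE.
Qed.

(** * Induction on the number of pieces *)

Section Decomposition.
Variables (R : realType) (n : nat) (J : finType) (mu : J -> seq nat).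
Hypotheses (mu_comp : forall j, is_composition (mu j)) (mu_sum : forall j, sumn (mu j) = n)
  (mu_len : forall j, (3 <= size (mu j))%N).

(** The combinatorial content of a polytope decomposition: coarsening gives the inclusion of the
    pieces, two classes covering the ground set make two pieces meet in a common face, and the cone
    condition makes the pieces cover. *)
Definition colouring_decomposition (S : {set J}) (l : seq nat)
    (c : 'I_n -> nat) (d : J -> 'I_n -> nat) : Prop :=
  [/\ has_fibres c l, forall j, j \in S -> has_fibres (d j) (mu j),
      forall j, j \in S -> forall x y, c x = c y -> d j x = d j y,
      forall i j, i \in S -> j \in S -> i != j ->
        exists a b, forall x, d i x = d i a \/ d j x = d j b
    & forall x : 'rV[R]_n, bases_cone (pair_bases finset.set0 c) x ->
        exists2 j, j \in S & bases_cone (pair_bases finset.set0 (d j)) x].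

(** Two parts are allowed for [l] because removing the last piece ends with the parts [n - p] and
    [p]. *)
Definition additive_imbalance (S : {set J}) (l : seq nat) : Prop :=
  [/\ is_composition l, sumn l = n, (2 <= size l)%N,
      (size l)%:R - 2 = \sum_(j in S) ((size (mu j))%:R - 2) :> rat
    & forall s, (0 < s < n)%N ->
        imbalance n l s = \sum_(j in S) imbalance n (mu j) s].

(* The largest part [p] of the [mu j], [j \in S]: if [t] is another part of the
   same [mu j0], then [n - t > p] is a part of no [mu j], so that the occurrences
   of [t] are not cancelled in the imbalance and show up in [l]. *)
Lemma rest_sub_parts S l j0 p : additive_imbalance S l -> j0 \in S -> p \in mu j0 ->
    (forall j q, j \in S -> q \in mu j -> (q <= p)%N) ->
  forall t, (count_mem t (rem p (mu j0)) <= count_mem t l)%N.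
Proof.
move=> [cl sl szl _ imb] j0S pmu max_p t.
have [|t_rest] := boolP (t \in rem p (mu j0)); last by rewrite (count_memPn t_rest).
move=> t_rest; have t_mu := mem_rem t_rest.
have muE := perm_to_rem pmu.
have t_lt : (0 < t < n)%N.
  by apply: (allP (composition_parts_lt (mu_comp j0) (mu_sum j0) (ltnW (mu_len j0)))).
(* Besides [p] and [t], [mu j0] has a third part. *)
have lt_p : (p < n - t)%N.
  have pt := perm_to_rem t_rest.
  have := mu_sum j0; rewrite (perm_sumn muE) /= (perm_sumn pt) /= => sE.
  have : (0 < sumn (rem t (rem p (mu j0))))%N.
    have : (0 < size (rem t (rem p (mu j0))))%N.
      by rewrite !size_rem //; case: (size (mu j0)) (mu_len j0) => [|[|[]]].
    have : is_composition (rem t (rem p (mu j0))).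
      by apply/allP => q /mem_rem /mem_rem; apply: (allP (mu_comp j0)).
    by case: (rem t _) => // q r /andP[q0 _] _; rewrite /= addn_gt0 q0.
  by lia.
have none j : j \in S -> count_mem (n - t)%N (mu j) = 0%N.
  by move=> jS; apply/count_memPn/negP => /(max_p _ _ jS); lia.
have := imb t t_lt; rewrite /imbalance (bigD1 j0) //= none // subr0 => E.
have rest0 : 0 <= \sum_(i in S | i != j0) ((count_mem t (mu i))%:R - (count_mem (n - t)%N (mu i))%:R) :> rat.
  by apply: sumr_ge0 => i /andP[iS _]; rewrite none // subr0 ler0n.
have le_mu : (count_mem t (mu j0))%:R <= (count_mem t l)%:R :> rat.
  have := ler0n rat (count_mem (n - t)%N l).
  move: E rest0; lra.
rewrite ler_nat in le_mu; apply: leq_trans le_mu.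
by rewrite count_rem leq_subr.
Qed.

(** Subtracting the imbalance of [mu j0] from that of [l] cancels the common parts and leaves minus
    that of the part [p], which is the imbalance of the merged part [n - p]. *)
Lemma additive_imbalance_step S l j0 p l2 : additive_imbalance S l -> j0 \in S ->
    p \in mu j0 -> perm_eq l (rem p (mu j0) ++ l2) ->
  additive_imbalance (S :\ j0) (sumn (rem p (mu j0)) :: l2).
Proof.
move=> [cl sl szl size_l imb] j0S pmu lE.
set rest := rem p (mu j0); have muE : perm_eq (mu j0) (p :: rest) := perm_to_rem pmu.
have sum_mu : (p + sumn rest = n)%N by rewrite -(mu_sum j0) (perm_sumn muE).
have p0 : (0 < p)%N by apply: (allP (mu_comp j0)).
have c_rest : is_composition rest.
  by apply/allP => q /mem_rem; apply: (allP (mu_comp j0)).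
have sz_mu : size (mu j0) = (size rest).+1 by rewrite (perm_size muE).
have s0 : (0 < sumn rest)%N.
  have := mu_len j0; rewrite sz_mu; case: (rest) c_rest => //= q r /andP[q0 _] _.
  by rewrite addn_gt0 q0.
have sz_l : size l = (size rest + size l2)%N by rewrite (perm_size lE) size_cat.
have sum_l : (sumn rest + sumn l2 = n)%N by rewrite -sl (perm_sumn lE) sumn_cat.
have c_l2 : is_composition l2.
  by move: cl; rewrite /is_composition (perm_all _ lE) all_cat => /andP[].
split.
- by rewrite /is_composition /= s0.
- by rewrite /=.
- have : (0 < sumn l2)%N by lia.
  by case: (l2).
- move: size_l; rewrite (big_setD1 j0) //= sz_l sz_mu natrD -!natr1 => size_l.
  by apply: (@addrI _ ((size rest)%:R + 1 - 2)); rewrite -size_l; ring.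
move=> u u0n; have := imb u u0n; rewrite (big_setD1 j0) //= => imb_u.
apply: (@addrI _ (imbalance n (mu j0) u)); rewrite -imb_u /imbalance.
have cnt v : count_mem v (mu j0) = ((p == v) + count_mem v rest)%N.
  by move/permP: muE => /(_ (pred1 v)).
have cntl v : count_mem v l = (count_mem v rest + count_mem v l2)%N.
  by move/permP: lE => /(_ (pred1 v)); rewrite count_cat.
rewrite !cnt !cntl /= (_ : (sumn rest == n - u)%N = (p == u)); last first.
  by apply/eqP/eqP; lia.
rewrite (_ : (sumn rest == u)%N = (p == n - u)%N); last by apply/eqP/eqP; lia.
rewrite !natrD; ring.
Qed.

Lemma exists_colouring_decomposition S l : additive_imbalance S l -> (3 <= size l)%N ->
  exists c d, colouring_decomposition S l c d.
Proof.
have [m] := ubnP #|S|; elim: m S l => // m IH S l; rewrite ltnS => cS addl szl.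
have [cl sl _ size_l _] := addl.
have S_neq0 : S != finset.set0.
  apply/eqP => S0; move: size_l; rewrite S0 big_set0 => /eqP.
  by rewrite subr_eq0 eqr_nat; move: szl; case: eqP => // ->.
have [j0 [p [j0S pmu max_p]]] : exists j0 p, [/\ j0 \in S, p \in mu j0 &
    forall j q, j \in S -> q \in mu j -> (q <= p)%N].
  pose P v := [exists j in S, v \in mu j].
  have le_n j q : q \in mu j -> (q <= n)%N.
    by move=> qj; rewrite -(mu_sum j) (perm_sumn (perm_to_rem qj)) leq_addr.
  have exP : exists v, P v.
    have /set0Pn[j jS] := S_neq0; exists (nth 0%N (mu j) 0); apply/exists_inP.
    by exists j => //; rewrite mem_nth // (leq_trans _ (mu_len j)).
  have ubP v : P v -> (v <= n)%N by move/exists_inP => [j _ /le_n].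
  case: (ex_maxnP exP ubP) => p /exists_inP[j0 j0S pmu] max_p.
  by exists j0, p; split => // j q jS qj; apply: max_p; apply/exists_inP; exists j.
have muE := perm_to_rem pmu.
have [l2 lE] : exists l2, perm_eq l (rem p (mu j0) ++ l2).
  have /count_subseqP[r sub_r rE] := rest_sub_parts addl j0S pmu max_p.
  have [l2 lE] := perm_to_subseq sub_r; exists l2.
  by rewrite (perm_trans lE) // perm_cat2r perm_sym.
have addl' := additive_imbalance_step addl j0S pmu lE.
set rest := rem p (mu j0) in muE lE addl'.
have [cl' sl' _ size_l' _] := addl'.
have sum_mu : (p + sumn rest = n)%N by rewrite -(mu_sum j0) (perm_sumn muE).
have p0 : (0 < p)%N by apply: (allP (mu_comp j0)).
have s0 : (0 < sumn rest)%N by have /andP[] := cl'.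
(* If [j0] is the only piece, additivity of sizes leaves a single part in [l2], so [l] is [mu j0] up
   to order. *)
have [S1|/set0Pn[j1 j1S]] := eqVneq (S :\ j0) finset.set0.
  have l2E : l2 = [:: p].
    move: size_l'; rewrite S1 big_set0 => /eqP; rewrite subr_eq0 eqr_nat eqSS /=.
    case: l2 sl' {lE cl' addl'} => [|q [|]] //= sl' _; congr [:: _].
    by move: sl' sum_mu; lia.
  have l_mu : perm_eq l (mu j0).
    by rewrite (perm_trans lE) // perm_sym (perm_trans muE) // l2E cats1 perm_sym perm_rcons.
  have [|c fc] := @has_fibres_exists 'I_n l; first by rewrite card_ord.
  have [c' fc' cc'] := has_fibres_perm fc l_mu.
  have in_S j : j \in S -> j = j0.
    move=> jS; apply/eqP; have : j \notin S :\ j0 by rewrite S1 inE.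
    by rewrite !inE jS andbT negbK.
  exists c, (fun=> c'); split => //.
  - by move=> j /in_S ->.
  - by move=> j _ x y /eqP; rewrite cc' => /eqP.
  - by move=> i j /in_S -> /in_S ->; rewrite eqxx.
  by move=> x Fx; exists j0 => //; rewrite -(pair_bases_kernel _ cc').
(* Each remaining piece adds at least one to the number of parts beyond two. *)
have szl' : (3 <= size (sumn rest :: l2))%N.
  rewrite -(@ltr_nat rat) -subr_gt0 size_l' (big_setD1 j1) //=.
  have big_ge0 : 0 <= \sum_(i in S :\ j0 :\ j1) ((size (mu i))%:R - 2) :> rat.
    by apply: sumr_ge0 => i _; rewrite subr_ge0 ler_nat ltnW.
  have : (0 : rat) < (size (mu j1))%:R - 2 by rewrite subr_gt0 ltr_nat.
  by move: big_ge0; lra.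
have [|c' [d' [fc' fd' d'c' cross' cone']]] := IH (S :\ j0) _ _ addl' szl'.
  by apply: leq_trans cS; rewrite (cardsD1 j0 S) j0S.
(* The merged part heads the list, so its class has colour 0. *)
have [c'_lt c'E] := fc'; pose A := [set x | c' x == 0%N].
have cA : #|A| = sumn rest by rewrite c'E.
have [g [g_lt gE]] := split_set cA.
(* In [c0] the class [A] is split by [g] into the parts of [rest], and the other colours, starting
   from 1 in [c'], are moved behind these. In [cm] the split of [A] is kept and its complement, of
   size [p], becomes one class. *)
pose c0 x := if x \in A then g x else (size rest + (c' x).-1)%N.
pose cm x := if x \in A then (g x).+1 else 0%N.
have notA x : x \notin A -> (0 < c' x)%N by rewrite inE lt0n.
have fc0 : has_fibres c0 (rest ++ l2).
  split=> [x|i]; rewrite size_cat.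
    rewrite /c0; case: (boolP (x \in A)) => xA; first by rewrite ltn_addr ?g_lt.
    by rewrite ltn_add2l; have := c'_lt x; have := notA x xA; case: (c' x).
  move=> lt_i; rewrite nth_cat; case: ltnP => le_i.
    rewrite -gE //; apply: eq_card => x; rewrite !inE /c0.
    case: (boolP (x \in A)) => xA; have := xA; rewrite inE; first by move->.
    by move=> /negPf -> /=; apply/negbTE; rewrite neq_ltn ltn_addr ?orbT.
  rewrite -[RHS]/(nth 0%N (sumn rest :: l2) (i - size rest).+1) -c'E; last first.
    by rewrite /= ltnS ltn_subLR.
  apply: eq_card => x; rewrite !inE /c0.
  case: (boolP (x \in A)) => xA; last first.
    by rewrite -(prednK (notA x xA)) eqSS -{1}(subnKC le_i) eqn_add2l.
  have := xA; rewrite inE => /eqP ->; apply/negbTE.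
  by rewrite neq_ltn (leq_trans (g_lt x xA)).
have fcm : has_fibres cm (p :: rest).
  split=> [x|[|i] lt_i] /=.
  - by rewrite /cm; case: (boolP (x \in A)) => // xA; rewrite ltnS g_lt.
  - have -> : p = #|~: A| by rewrite cardsCs finset.setCK card_ord cA -sum_mu addnK.
    by apply: eq_card => x; rewrite !inE /cm inE; case: (c' x =P 0%N).
  rewrite -gE //; apply: eq_card => x; rewrite !inE /cm inE.
  by case: (c' x =P 0%N).
have [c fc c0c] := has_fibres_perm fc0 (etrans (perm_sym _ _) lE).
have [cmu fcmu cmcmu] := has_fibres_perm fcm (etrans (perm_sym _ _) muE).
have lt_c0 x y : x \in A -> y \notin A -> (c0 x == c0 y) = false.
  move=> xA yA; rewrite /c0 xA (negPf yA); apply/negbTE.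
  by rewrite neq_ltn ltn_addr ?g_lt.
have c'A x y : x \in A -> y \notin A -> (c' x == c' y) = false.
  by move=> + /notA; rewrite inE => /eqP -> ; case: (c' y).
have c1E x y : (c' x == c' y) = if (x \in A) && (y \in A) then true
    else if (x \in A) || (y \in A) then false else c x == c y.
  rewrite -c0c; case: (boolP (x \in A)) => xA; case: (boolP (y \in A)) => yA /=.
  - by move: xA yA; rewrite !inE => /eqP -> /eqP ->.
  - exact: c'A.
  - by rewrite eq_sym; exact: c'A.
  rewrite /c0 (negPf xA) (negPf yA) eqn_add2l.
  by have := notA x xA; have := notA y yA; case: (c' x) => // ?; case: (c' y).
have c2E x y : (cmu x == cmu y) = if (x \in A) && (y \in A) then c x == c y
    else if (x \in A) || (y \in A) then false else true.
  rewrite -c0c -cmcmu /cm; case: (boolP (x \in A)) => xA; case: (boolP (y \in A)) => yA //=.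
  by rewrite /c0 xA yA eqSS.
have cA' x y : x \in A -> y \notin A -> c x != c y.
  by move=> xA yA; rewrite -c0c lt_c0.
have coarse' x y : c x = c y -> c' x = c' y.
  move/eqP=> cxy; apply/eqP; rewrite c1E cxy.
  case: (boolP (x \in A)) => xA; case: (boolP (y \in A)) => yA //=.
    by rewrite (negPf (cA' x y xA yA)) in cxy.
  by rewrite eq_sym (negPf (cA' y x yA xA)) in cxy.
have coarse_mu x y : c x = c y -> cmu x = cmu y.
  move/eqP=> cxy; apply/eqP; rewrite c2E cxy.
  case: (boolP (x \in A)) => xA; case: (boolP (y \in A)) => yA //=.
    by rewrite (negPf (cA' x y xA yA)) in cxy.
  by rewrite eq_sym (negPf (cA' y x yA xA)) in cxy.
have [a aA] : exists a, a \in A by apply/card_gt0P; rewrite cA.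
have [b bA] : exists b, b \notin A.
  have : (0 < #|~: A|)%N by rewrite cardsCs finset.setCK card_ord cA -sum_mu addnK.
  by move/card_gt0P => [b]; rewrite inE; exists b.
(* The complement of [A] is one class of [cmu], and [A] lies in one class of [d' j], which is
   coarser than [c']. *)
have cross_mu j : j \in S :\ j0 -> forall x, cmu x = cmu b \/ d' j x = d' j a.
  move=> jS x; case: (boolP (x \in A)) => xA; [right | left].
    by apply: d'c' => //; apply/eqP; rewrite c1E xA aA.
  by apply/eqP; rewrite c2E (negPf xA) (negPf bA).
have S'P j : j \in S -> j != j0 -> j \in S :\ j0 by rewrite !inE => -> ->.
exists c, (fun j => if j == j0 then cmu else d' j); split => //.
- by move=> j jS /=; case: (eqVneq j j0) => [->|/(S'P j jS)/fd'].
- move=> j jS x y /[dup] /coarse_mu Emu /coarse' E' /=; case: (eqVneq j j0) => // nj.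
  exact: (d'c' j (S'P j jS nj)).
- move=> i j iS jS; rewrite /=; case: (eqVneq i j0) => [iE|ni]; case: (eqVneq j j0) => [jE|nj].
  + by rewrite iE jE eqxx.
  + by move=> _; exists b, a; apply: cross_mu; apply: S'P.
  + move=> _; exists a, b => x; have [] := cross_mu i (S'P i iS ni) x; by [right | left].
  by move=> ij; apply: cross' => //; apply: S'P.
move=> x /(split_cone c1E c2E cA')[/cone'[j jS' Fx]|Fx]; last first.
  by exists j0; rewrite ?eqxx.
move: jS'; rewrite !inE => /andP[nj jS].
by exists j => //; rewrite (negPf nj).
Qed.

End Decomposition.

(** Every vertex has coordinate sum two, so this value forces the weights of a cone representation
    to sum to one. *)
Lemma base_polytopeP (R : realType) n (M : matroid 'I_n) (c : 'I_n -> nat) (x : 'rV[R]_n) :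
  bases M = pair_bases finset.set0 c ->
  base_polytope M x <-> bases_cone (pair_bases finset.set0 c) x /\ dot (indicator R finset.setT) x = 2.
Proof.
move=> ME; have vertex2 B : B \in bases M -> dot (indicator R finset.setT) (basis_vertex R B) = 2.
  rewrite ME => /pair_basesP[y [z [_ _ cyz ->]]].
  have yz : y != z by apply: contraNneq cyz => ->.
  by rewrite dot_indicator_set2 // !finset.in_setT.
split=> [Mx|[[w [w0 xE]] x2]].
  split; last exact: dot_polytope_eq vertex2 Mx.
  by have [w [w0 _ xE]] := Mx; exists w; rewrite -ME.
exists w; split; rewrite ?ME //.
apply: (@mulIf _ 2); rewrite ?pnatr_eq0 // mul1r -[RHS]x2 xE dot_sum mulr_suml.
by apply: eq_bigr => B BM; rewrite vertex2 ?ME.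
Qed.

(* The finite multiset J of partitions is the family (mu j), j : J. The
   hypothesis evaluates F on arbitrary members M0, N0 j of the isomorphism
   classes; F is constant on each class. *)
Theorem theorem6p2 (R : realType) (n : nat) (lam : seq nat)
    (J : finType) (mu : J -> seq nat)
    (lam_part : is_partition n lam) (lam_len : (3 <= size lam)%N)
    (mu_part : forall j, is_partition n (mu j))
    (mu_len : forall j, (3 <= size (mu j))%N)
    (M0 : matroid 'I_n) (N0 : J -> matroid 'I_n)
    (M0_class : in_rank2_class lam M0)
    (N0_class : forall j, in_rank2_class (mu j) (N0 j))
    (F_eq : eq_mod_ideal_sq (F_matroid M0) (\sum_(j : J) F_matroid (N0 j))) :
  exists (M : matroid 'I_n) (N : J -> matroid 'I_n),
    [/\ in_rank2_class lam M,
        forall j, in_rank2_class (mu j) (N j)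
      & base_polytope_decomposition R M N].
Proof.
have [_ lam_comp /eqP lam_sum] := and3P lam_part.
have mu_comp j : is_composition (mu j) by have /and3P[] := mu_part j.
have mu_sum j : sumn (mu j) = n by have /and3P[_ _ /eqP] := mu_part j.
have lam_lt := composition_parts_lt lam_comp lam_sum (ltnW lam_len).
have mu_lt j := composition_parts_lt (mu_comp j) (mu_sum j) (ltnW (mu_len j)).
have n3 : (2 < n)%N.
  rewrite -lam_sum (leq_trans lam_len) //.
  elim: (lam) lam_comp => //= p t IH /andP[p0 /IH le].
  by rewrite -add1n leq_add.
have addl : additive_imbalance n mu [set: J] lam.
  split => //; first exact: ltnW.
    rewrite (size_additive lam_lt lam_sum n3 mu_lt mu_sum M0_class N0_class F_eq).
    by apply: eq_bigl => j; rewrite finset.in_setT.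
  move=> s sn.
  rewrite (imbalance_additive lam_lt lam_sum n3 mu_lt mu_sum M0_class N0_class F_eq) //.
  by apply: eq_bigl => j; rewrite finset.in_setT.
have [c [d [fc fd dc cross cone]]] :=
  exists_colouring_decomposition R mu_comp mu_sum mu_len addl lam_len.
have inT j : j \in [set: J] by rewrite finset.in_setT.
have matroid_of (f : 'I_n -> nat) t : has_fibres f t -> is_composition t ->
    (3 <= size t)%N -> exists M : matroid 'I_n, bases M = pair_bases finset.set0 f.
  move=> ff ct st; have n0 : (0 < n)%N by lia.
  have [y fy] := has_fibres_neq (Ordinal n0) ff ct (ltnW st).
  by apply: (pair_matroid_exists (x := y) (y := Ordinal n0)); rewrite ?inE.
have [M ME] := matroid_of c lam fc lam_comp lam_len.
have [N NE] := choice (fun j => matroid_of (d j) (mu j) (fd j (inT j)) (mu_comp j) (mu_len j)).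
exists M, N; split.
- exact: pair_matroid_class ME fc lam_comp (ltnW lam_len).
- by move=> j; apply: pair_matroid_class (NE j) (fd j (inT j)) (mu_comp j) (ltnW (mu_len j)).
split.
  (* A point of the polytope lies in the cone of some piece and keeps its coordinate sum two there;
     the converse inclusion is coarsening. *)
  apply/seteqP; split=> [x /(base_polytopeP _ ME)[/cone[j _ Nx] x2]|x [j _]].
    by exists j => //; apply/(base_polytopeP _ (NE j)).
  apply: base_polytope_sub; rewrite ME NE; apply: pair_bases_coarser.
  exact: dc j (inT j).
move=> i j ij; have [a [b ab]] := cross i j (inT i) (inT j) ij.
have [p dp] := has_fibres_neq a (fd i (inT i)) (mu_comp i) (ltnW (mu_len i)).
have [q dq] := has_fibres_neq b (fd j (inT j)) (mu_comp j) (ltnW (mu_len j)).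
exact: polytope_intersection (NE i) (NE j) ab dp dq.
Qed.
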